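(* Assume that one of the hypotheses (Sub), (Sup-1), (Sup-0), (Crit-1), (Crit-2), (Crit-3) described in the context holds. Then for each $m\in\mathbb N$, the lexicographically ordered cycle lengths $L_1,\dots,L_m$ are asymptotically independent as $N\to\infty$ and, for any $\ell_1,\dots,\ell_m\in\mathbb N$, $$\lim_{N\to\infty}\mathbb P_N\{L_1=\ell_1,\dots,L_m=\ell_m\}=\prod_{j=1}^m\kappa_{\ell_j}r_*^{\ell_j}.$$
   Context: Model: for $N\in\mathbb N$, $S_N$ is the symmetric group on $\{1,\dots,N\}$; for $\sigma\in S_N$, $C_j=C_j(\sigma)$ is the number of cycles of length $j$ in $\sigma$. Given sequences of nonnegative reals $(\theta_j)_{j\ge1}$, $(\kappa_j)_{j\ge1}$, the probability measure $\mathbb P_N$ on $S_N$ is $\mathbb P_N(\sigma)=\frac{1}{N!H_N}\prod_{j=1}^N(\theta_j+N\kappa_j)^{C_j}$ with $H_N=\frac1{N!}\sum_{\sigma\in S_N}\prod_{j=1}^N(\theta_j+N\kappa_j)^{C_j}$. Lexicographic ordering: $L_1(\sigma)$ is the length of the cycle of $\sigma$ containing $1$, $L_2(\sigma)$ the length of the cycle containing the smallest element not in the first cycle, and so on. Generating functions: $g_\theta(z)=\sum_{j\ge1}\theta_jz^j/j$, $g_\kappa(z)=\sum_{j\ge1}\kappa_jz^j/j$. For a function $g$, $g^{\{n\}}(z):=z^n g^{(n)}(z)$. $R\in(0,\infty]$ is the radius of convergence of $g_\kappa$, and $g_\kappa^{\{n\}}(R):=\lim_{r\uparrow R}g_\kappa^{\{n\}}(r)\in[0,\infty]$.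 Standing assumption: $(\kappa_j)$ is non-arithmetic (there is no integer $j_0>1$ such that $\kappa_j\ne0$ implies that $j_0$ divides $j$) and $\kappa_j>0$ for some $j\ge2$. For $\eta>0$, $\varphi\in(0,\pi/2)$, $\Delta_0=\{z\in\mathbb C:|z|<R|1+\eta e^{i\varphi}|,\ z\ne R,\ |\arg(z-R)|>\varphi\}$; ''holomorphic in some $\Delta_0$'' means for some such $\eta,\varphi$. Logarithms and non-integer powers of $1-z/R$ use principal branches. Hypotheses: (Sub) $g_\theta,g_\kappa$ both have radius of convergence $R>0$ and $1<g_\kappa^{\{1\}}(R)\le\infty$. (Sup-1) $g_\theta,g_\kappa$ both have radius of convergence $R>0$, are holomorphic in some $\Delta_0$, $g_\kappa^{\{1\}}(R)<1$, and as $z\to R$, $z\in\Delta_0$: $g_\theta(z)=-\theta^*\log(1-z/R)+O((1-z/R)^\delta)$ and $g_\kappa(z)=g_\kappa(R)-g_\kappa^{\{1\}}(R)(1-z/R)+O((1-z/R)^{1+\delta})$, for some $\theta^*>0$, $\delta>0$. (Sup-0) $g_\kappa$ has radius of convergence $R>0$ and is holomorphic in some $\Delta_0$, $g_\kappa^{\{1\}}(R)<1$, there is a non-integer $s>1$ with $g_\kappa^{\{n\}}(R)<\infty$ for all integers $n<s$ and $g_\kappa^{\{n\}}(R)=\infty$ for $n>s$, and as $z\to R$, $z\in\Delta_0$, $g_\kappa(z)=\sum_{0\le n<s}\frac{(-1)^ng_\kappa^{\{n\}}(R)}{n!}(1-z/R)^n+a_s(1-z/R)^s+O((1-z/R)^{s+\delta})$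 with $a_s>0$, $\delta>0$; $g_\theta$ is holomorphic in $\Delta_0$ and regular (holomorphic in a neighbourhood of) at $z=R$. (Crit-1) $g_\theta,g_\kappa$ both have radius of convergence $R>0$, $g_\theta(R)<\infty$, $g_\kappa(R)<\infty$, $g_\kappa^{\{1\}}(R)=1$, $0<g_\kappa^{\{2\}}(R)<\infty$. (Crit-2) $g_\theta,g_\kappa$ both have radius of convergence $R>0$ and are holomorphic in some $\Delta_0$, $g_\kappa^{\{1\}}(R)=1$, $0<g_\kappa^{\{2\}}(R)<\infty$, and as $z\to R$, $z\in\Delta_0$: $g_\theta(z)=-\theta^*\log(1-z/R)+O((1-z/R)^\delta)$ with $\theta^*\ge0$, $\delta>0$, and $g_\kappa(z)=g_\kappa(R)-(1-z/R)+\frac12 g_\kappa^{\{2\}}(R)(1-z/R)^2+O((1-z/R)^{2+\delta})$. (Crit-3) as (Crit-2) but without the condition on $g_\kappa^{\{2\}}(R)$ and with the expansion of $g_\kappa$ replaced by $g_\kappa(z)=g_\kappa(R)-(1-z/R)+a_s(1-z/R)^s+O((1-z/R)^{s+\delta})$ with $s\in(1,2)$, $a_s>0$. Definition of $r_*$: if $g_\kappa^{\{1\}}(R)\ge1$, $r_*=r_1$, the unique $r\in(0,R]$ with $g_\kappa^{\{1\}}(r)=1$; if $g_\kappa^{\{1\}}(R)<1$, $r_*=R$. *)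

(* Defs.v *)
From Stdlib Require Import Reals Lra.
From Coquelicot Require Import Coquelicot.
From mathcomp Require Import ssreflect ssrfun ssrbool eqtype ssrnat seq choice div
  fintype finset fingroup perm.

Set Implicit Arguments.
Unset Strict Implicit.
Unset Printing Implicit Defensive.

Open Scope R_scope.

Definition sumR (l : seq R) : R := foldr Rplus 0 l.
Definition prodR (l : seq R) : R := foldr Rmult 1 l.

(* The point k+1 of {1,..,N} is represented by the ordinal k.          *)

Definition cyc_count (N : nat) (s : {perm 'I_N}) (j : nat) : nat :=
  #|[set c in porbits s | #|c| == j]|.

Definition weight (theta kappa : nat -> R) (N : nat) (s : {perm 'I_N}) : R :=
  prodR (map (fun j => (theta j + INR N * kappa j) ^ cyc_count s j) (iota 1 N)).

Definition HN (theta kappa : nat -> R) (N : nat) : R :=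
  sumR (map (@weight theta kappa N) (enum {perm 'I_N})) / INR (Factorial.fact N).

Definition PN (theta kappa : nat -> R) (N : nat) (s : {perm 'I_N}) : R :=
  weight theta kappa s / (INR (Factorial.fact N) * HN theta kappa N).

Definition PNev (theta kappa : nat -> R) (N : nat) (E : pred {perm 'I_N}) : R :=
  sumR (map (@PN theta kappa N) [seq s <- enum {perm 'I_N} | E s]).

(* smallest point not in S (enum 'I_N is increasing) *)
Definition first_out (N : nat) (S : {set 'I_N}) : option 'I_N :=
  ohead [seq x <- enum 'I_N | x \notin S].

Fixpoint lex_covered (N : nat) (s : {perm 'I_N}) (k : nat) : {set 'I_N} :=
  match k with
  | 0 => set0
  | k'.+1 => let S := lex_covered s k' in
             match first_out S with
             | Some x => S :|: porbit s x
             | None => S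
             end
  end.

(* L_k(sigma), k >= 1 (convention: 0 if sigma has fewer than k cycles) *)
Definition lexL (N : nat) (s : {perm 'I_N}) (k : nat) : nat :=
  match k with
  | 0 => 0
  | k'.+1 => match first_out (lex_covered s k') with
             | Some x => #|porbit s x|
             | None => 0
             end
  end.

Definition gcoef (c : nat -> R) (n : nat) : R :=
  match n with 0 => 0 | _ => c n / INR n end.

Definition gfun (c : nat -> R) (r : R) : R := PSeries (gcoef c) r.

Definition gdn (c : nat -> R) (n : nat) (r : R) : R :=
  r ^ n * Derive_n (gfun c) n r.

Definition radius (c : nat -> R) : Rbar := CV_radius (gcoef c).

Definition toR (R0 : Rbar) : (R -> Prop) -> Prop :=
  match R0 with
  | Rbar.Finite r => at_left r
  | p_infty => Rbar_locally p_infty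
  | m_infty => at_left 0
  end.

Definition gdnR (c : nat -> R) (n : nat) (l : Rbar) : Prop :=
  filterlim (gdn c n) (toR (radius c)) (Rbar_locally l).

(* principal argument in (-pi, pi] *)
Definition Carg (w : Complex.C) : R :=
  let x := fst w in let y := snd w in
  if Req_EM_T (Cmod w + x) 0 then (if Req_EM_T x 0 then 0 else PI)
  else 2 * atan (y / (Cmod w + x)).

Definition Clog (w : Complex.C) : Complex.C := (ln (Cmod w), Carg w).

(* principal power w^a for real a (w <> 0) *)
Definition Cpowr (w : Complex.C) (a : R) : Complex.C :=
  (Rpower (Cmod w) a * cos (a * Carg w), Rpower (Cmod w) a * sin (a * Carg w)).

Definition Delta0 (R0 eta phi : R) (z : Complex.C) : Prop :=
  Cmod z < R0 * Cmod (Cplus 1 (RtoC eta * (cos phi, sin phi))%C) /\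
  z <> RtoC R0 /\ phi < Rabs (Carg (Cminus z (RtoC R0))).

Definition holo_at (G : Complex.C -> Complex.C) (z : Complex.C) : Prop :=
  ex_derive (K := C_AbsRing) (V := C_NormedModule) G z.

Definition extends_g (c : nat -> R) (R0 : R) (G : Complex.C -> Complex.C) : Prop :=
  forall z : Complex.C, Cmod z < R0 ->
    is_pseries (K := C_AbsRing) (V := C_NormedModule)
      (fun n => RtoC (gcoef c n)) z (G z).

Definition bigO_at_R (R0 eta phi : R) (F M : Complex.C -> Complex.C) (e : R) : Prop :=
  exists K rho, 0 < rho /\ forall z, Delta0 R0 eta phi z ->
    Cmod (Cminus z (RtoC R0)) < rho ->
    Cmod (Cminus (F z) (M z)) <= K * Rpower (Cmod (Cminus 1 (Cdiv z (RtoC R0)))) e.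

Definition wR (R0 : R) (z : Complex.C) : Complex.C := Cminus 1 (Cdiv z (RtoC R0)).

Definition Csum (l : seq Complex.C) : Complex.C := foldr Cplus (RtoC 0) l.

Definition holo_on_Delta0 (R0 eta phi : R) (G : Complex.C -> Complex.C) : Prop :=
  forall z, Delta0 R0 eta phi z -> holo_at G z.

Definition non_arithmetic (kappa : nat -> R) : Prop :=
  ~ (exists j0 : nat, (1 < j0)%N /\
       forall j : nat, (1 <= j)%N -> kappa j <> 0 -> (j0 %| j)%N).

Definition standing (theta kappa : nat -> R) : Prop :=
  (forall j, 0 <= theta j) /\ (forall j, 0 <= kappa j) /\
  non_arithmetic kappa /\ (exists j, (2 <= j)%N /\ 0 < kappa j).

Definition Hyp_Sub (theta kappa : nat -> R) : Prop :=
  radius theta = radius kappa /\ Rbar_lt 0 (radius kappa) /\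
  exists l : Rbar, gdnR kappa 1 l /\ Rbar_lt 1 l.

Definition Hyp_Sup1 (theta kappa : nat -> R) : Prop :=
  exists R0 : R, radius theta = Rbar.Finite R0 /\ radius kappa = Rbar.Finite R0 /\ 0 < R0 /\
  exists (eta phi : R) (Gt Gk : Complex.C -> Complex.C),
    0 < eta /\ 0 < phi < PI / 2 /\
    extends_g theta R0 Gt /\ holo_on_Delta0 R0 eta phi Gt /\
    extends_g kappa R0 Gk /\ holo_on_Delta0 R0 eta phi Gk /\
    exists gk0 gk1 : R, gdnR kappa 0 (Rbar.Finite gk0) /\ gdnR kappa 1 (Rbar.Finite gk1) /\
    gk1 < 1 /\
    exists thetas delta : R, 0 < thetas /\ 0 < delta /\
    bigO_at_R R0 eta phi Gt
      (fun z => Cmult (RtoC (- thetas)) (Clog (wR R0 z))) delta /\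
    bigO_at_R R0 eta phi Gk
      (fun z => Cminus (RtoC gk0) (Cmult (RtoC gk1) (wR R0 z))) (1 + delta).

Definition Hyp_Sup0 (theta kappa : nat -> R) : Prop :=
  exists R0 : R, radius kappa = Rbar.Finite R0 /\ 0 < R0 /\
  exists (eta phi : R) (Gt Gk : Complex.C -> Complex.C),
    0 < eta /\ 0 < phi < PI / 2 /\
    extends_g kappa R0 Gk /\ holo_on_Delta0 R0 eta phi Gk /\
    extends_g theta R0 Gt /\ holo_on_Delta0 R0 eta phi Gt /\
    (exists eps, 0 < eps /\ forall z, Cmod (Cminus z (RtoC R0)) < eps -> holo_at Gt z) /\
    exists (s : R) (k : nat), (1 <= k)%N /\ INR k < s < INR k + 1 /\
    exists c : nat -> R,
      (forall n : nat, (n <= k)%N -> gdnR kappa n (Rbar.Finite (c n))) /\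
      (forall n : nat, (k < n)%N -> gdnR kappa n p_infty) /\
      c 1%N < 1 /\
      exists a_s delta : R, 0 < a_s /\ 0 < delta /\
      bigO_at_R R0 eta phi Gk
        (fun z => Cplus
           (Csum (map (fun n => Cmult (RtoC ((-1) ^ n * c n / INR (Factorial.fact n)))
                                      (Cpow (wR R0 z) n)) (iota 0 k.+1)))
           (Cmult (RtoC a_s) (Cpowr (wR R0 z) s)))
        (s + delta).

Definition Hyp_Crit1 (theta kappa : nat -> R) : Prop :=
  radius theta = radius kappa /\ Rbar_lt 0 (radius kappa) /\
  (exists gt0 : R, gdnR theta 0 (Rbar.Finite gt0)) /\
  (exists gk0 : R, gdnR kappa 0 (Rbar.Finite gk0)) /\
  gdnR kappa 1 (Rbar.Finite 1) /\
  (exists gk2 : R, gdnR kappa 2 (Rbar.Finite gk2) /\ 0 < gk2).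

Definition Hyp_Crit2 (theta kappa : nat -> R) : Prop :=
  exists R0 : R, radius theta = Rbar.Finite R0 /\ radius kappa = Rbar.Finite R0 /\ 0 < R0 /\
  exists (eta phi : R) (Gt Gk : Complex.C -> Complex.C),
    0 < eta /\ 0 < phi < PI / 2 /\
    extends_g theta R0 Gt /\ holo_on_Delta0 R0 eta phi Gt /\
    extends_g kappa R0 Gk /\ holo_on_Delta0 R0 eta phi Gk /\
    gdnR kappa 1 (Rbar.Finite 1) /\
    exists gk0 gk2 : R, gdnR kappa 0 (Rbar.Finite gk0) /\
    gdnR kappa 2 (Rbar.Finite gk2) /\ 0 < gk2 /\
    exists thetas delta : R, 0 <= thetas /\ 0 < delta /\
    bigO_at_R R0 eta phi Gt
      (fun z => Cmult (RtoC (- thetas)) (Clog (wR R0 z))) delta /\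
    bigO_at_R R0 eta phi Gk
      (fun z => Cplus (Cminus (RtoC gk0) (wR R0 z))
                      (Cmult (RtoC (gk2 / 2)) (Cpow (wR R0 z) 2))) (2 + delta).

Definition Hyp_Crit3 (theta kappa : nat -> R) : Prop :=
  exists R0 : R, radius theta = Rbar.Finite R0 /\ radius kappa = Rbar.Finite R0 /\ 0 < R0 /\
  exists (eta phi : R) (Gt Gk : Complex.C -> Complex.C),
    0 < eta /\ 0 < phi < PI / 2 /\
    extends_g theta R0 Gt /\ holo_on_Delta0 R0 eta phi Gt /\
    extends_g kappa R0 Gk /\ holo_on_Delta0 R0 eta phi Gk /\
    gdnR kappa 1 (Rbar.Finite 1) /\
    exists gk0 : R, gdnR kappa 0 (Rbar.Finite gk0) /\
    exists thetas delta s a_s : R, 0 <= thetas /\ 0 < delta /\ 1 < s < 2 /\ 0 < a_s /\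
    bigO_at_R R0 eta phi Gt
      (fun z => Cmult (RtoC (- thetas)) (Clog (wR R0 z))) delta /\
    bigO_at_R R0 eta phi Gk
      (fun z => Cplus (Cminus (RtoC gk0) (wR R0 z))
                      (Cmult (RtoC a_s) (Cpowr (wR R0 z) s))) (s + delta).

(* r_* : if g_kappa^{1}(R) >= 1, the r in (0,R] with g_kappa^{1}(r) = 1
   (at r = R understood as the limit value); otherwise r_* = R. *)
Definition is_rstar (kappa : nat -> R) (rs : R) : Prop :=
  (exists l : Rbar, gdnR kappa 1 l /\ Rbar_le 1 l /\ 0 < rs /\
     ((Rbar_lt rs (radius kappa) /\ gdn kappa 1 rs = 1) \/
      (Rbar.Finite rs = radius kappa /\ gdnR kappa 1 (Rbar.Finite 1)))) \/
  (exists l : Rbar, gdnR kappa 1 l /\ Rbar_lt l 1 /\ Rbar.Finite rs = radius kappa).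

(* Main.v *)
Require Import Defs.
From Stdlib Require Import Reals Lra Lia.
From Coquelicot Require Import Coquelicot.
From HB Require Import structures.
From mathcomp Require Import ssreflect ssrfun ssrbool eqtype ssrnat seq choice
  div fintype finset bigop fingroup perm action binomial zify.

Set Implicit Arguments.
Unset Strict Implicit.
Unset Printing Implicit Defensive.

Open Scope R_scope.

(* Fix N, put w_j = theta_j + N kappa_j and h_n = [z^n] exp(sum_j w_j z^j / j).
   Summing over the cycle through the smallest uncovered point, one cycle at a
   time, gives
     P_N(L_1 = l_1, .., L_m = l_m)
       = prod_i w_(l_i) / (N - l_1 - .. - l_(i-1)) * h_(N - l_1 - .. - l_m) / h_N,
   so it suffices that h_(N-a) / h_N -> rs^a.  No singularity analysis is
   needed for this ratio limit.  If kappa_j > 0, then (w_j / j) h_(n-j) / h_n is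
   the mean number of parts j in a random configuration of total size n; by
   Jensen's inequality, for every t,
     t (w_j / j) h_(n-j) / h_n <= log (h_n with w_j replaced by w_j e^t) - log h_n.
   The first logarithm is bounded above by
     g_theta(r) + N g_kappa(r) + (w_j / j) (e^t - 1) r^j - n log r  for r < rs,
   and log h_n is bounded below, up to o(N), by N g_kappa(rs) - n log r for
   r > rs: a single configuration suffices, with multiplicities interpolating
   between N kappa_j rs^j / j and N kappa_j r^j / j.  Dividing by N and letting
   r -> rs, then t -> 0 from both sides, gives h_(n-j) / h_n -> rs^j for n = N + O(1).
   As the support of kappa has gcd 1, it generates two consecutive integers, whence
   the ratio limit for a = 1 and then for all a.
   All six hypotheses enter only through: g_theta converges below rs, the partial
   sums of sum_j kappa_j rs^j are at most 1, and those of sum_j kappa_j r^j exceed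
   1 for every r > rs. *)

(** * Permutations split along a cycle *)

HB.instance Definition _ := Monoid.isComLaw.Build R 0 Rplus
  (fun x y z => esym (Rplus_assoc x y z)) Rplus_comm Rplus_0_l.
HB.instance Definition _ := Monoid.isComLaw.Build R 1 Rmult
  (fun x y z => esym (Rmult_assoc x y z)) Rmult_comm Rmult_1_l.
HB.instance Definition _ := Monoid.isMulLaw.Build R 0 Rmult Rmult_0_l Rmult_0_r.
HB.instance Definition _ := Monoid.isAddLaw.Build R Rmult Rplus
  Rmult_plus_distr_r Rmult_plus_distr_l.

Section PermSplit.
Variable T : finType.
Implicit Types (s p q : {perm T}) (S c : {set T}) (x y : T).

Lemma iter_porbitP s x y : reflect (exists i, y = iter i s x) (y \in porbit s x).
Proof.
by apply: (iffP (porbitP s x y)) => -[i ->]; exists i; rewrite ?permX // -permX.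
Qed.

Lemma perm_in_porbit s x y : y \in porbit s x -> s y \in porbit s x.
Proof. by case/iter_porbitP=> i ->; apply/iter_porbitP; exists i.+1. Qed.

Lemma porbit_eq_on s q (P : pred T) x :
  P x -> (forall y, P y -> s y = q y /\ P (s y)) -> porbit s x = porbit q x.
Proof.
move=> Px H.
have E i : iter i s x = iter i q x /\ P (iter i s x).
  elim: i => [|i [IH Pi]] //=; have [E1 P1] := H _ Pi.
  by split=> //; rewrite E1 IH.
apply/setP=> y; apply/iter_porbitP/iter_porbitP=> -[i ->]; exists i;
  by have [-> _] := E i.
Qed.

Lemma porbit_sub_on s S x : perm_on S s -> x \in S -> porbit s x \subset S.
Proof.
move=> sS xS; apply/subsetP=> y /iter_porbitP [i ->].
by elim: i => //= i IH; rewrite (perm_closed _ sS).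
Qed.

Lemma stab_porbit s x : s \in ('N(porbit s x | 'P))%g.
Proof.
rewrite !inE; apply/subsetP => y yx; rewrite inE /= apermE.
exact: perm_in_porbit.
Qed.

Section OnBlock.
Variables (S c : {set T}) (x : T) (p : {perm T}).
Hypotheses (cS : c \subset S) (pc : perm_on c p) (px : porbit p x = c).

Lemma mulperm_out q y : y \notin c -> (p * q)%g y = q y.
Proof. by move=> yc; rewrite permM (out_perm pc). Qed.

Lemma mulperm_in q y : perm_on (S :\: c) q -> y \in c -> (p * q)%g y = p y.
Proof.
move=> qS yc; rewrite permM (out_perm qS) // inE negb_and negbK.
by rewrite (perm_closed _ pc) yc.
Qed.

Lemma porbit_mulperm_in q y : perm_on (S :\: c) q -> y \in c ->
  porbit (p * q)%g y = c.
Proof.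
move=> qS yc; rewrite (@porbit_eq_on _ p (mem c)) //; last first.
  by move=> z zc; rewrite mulperm_in //; split=> //; rewrite inE (perm_closed _ pc).
by rewrite -px; apply/eqP; rewrite eq_porbit_mem px.
Qed.

Lemma porbit_mulperm_out q y : perm_on (S :\: c) q -> y \notin c ->
  porbit (p * q)%g y = porbit q y.
Proof.
move=> qS yc; apply: (@porbit_eq_on _ q (predC (mem c))) => // z /= zc.
rewrite mulperm_out //; split=> //.
have [zS|zS] := boolP (z \in S :\: c).
  by rewrite -(perm_closed _ qS) inE in zS; case/andP: zS.
by rewrite (out_perm qS).
Qed.

(** Once [p] is fixed, the three conditions on the product amount to one on [q] alone. Hence
    permutations of [S] whose cycle through [x] is [c] correspond to pairs of a cycle on [c] and a
    permutation of the rest. *)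
Lemma mulperm_blockP q :
  [&& perm_on S (p * q)%g, porbit (p * q)%g x == c & restr_perm c (p * q)%g == p]
  = perm_on (S :\: c) q.
Proof.
have xc : x \in c by rewrite -px porbit_id.
apply/and3P/idP => [[pqS /eqP pqx /eqP rp]|qS].
  apply/subsetP=> y; rewrite inE; apply: contraR => /=; rewrite inE negb_and negbK.
  have stab : (p * q)%g \in 'N(c | 'P)%g by rewrite -pqx stab_porbit.
  (* On [c], [q] fixes y = p z because the product restricts to [p] there; outside [S], [p] is the
     identity and the product fixes [y]. *)
  case/orP=> [yc|yS].
    have zc : (p^-1)%g y \in c by rewrite (perm_closed _ (perm_onV pc)).
    have := restr_permE stab zc; rewrite rp permM permKV => E.
    by rewrite -E.
  rewrite -mulperm_out ?(out_perm pqS) //.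
  by apply: contra yS; apply: (subsetP cS).
split.
- apply: perm_onM; last first.
    by apply: subset_trans qS _; apply: subsetDl.
  exact: subset_trans pc cS.
- by rewrite porbit_mulperm_in.
- have stab : (p * q)%g \in 'N(c | 'P)%g.
    by rewrite -(porbit_mulperm_in qS xc) stab_porbit.
  apply/eqP/permP=> y; have [yc|yc] := boolP (y \in c).
    by rewrite restr_permE // mulperm_in.
  by rewrite (out_perm (restr_perm_on _ _)) // (out_perm pc).
Qed.

End OnBlock.

Lemma restr_porbit s x : let c := porbit s x in
  perm_on c (restr_perm c s) /\ porbit (restr_perm c s) x = c.
Proof.
move=> c; split; first exact: restr_perm_on.
apply: (@porbit_eq_on _ s (mem c)); first by rewrite inE porbit_id.
move=> y yc; rewrite restr_permE ?stab_porbit //; split=> //.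
exact: perm_in_porbit.
Qed.

(** The sum is sorted by the support [c] of the cycle through [x], then by the restriction [p] of
    [s] to [c]; translation by [p] leaves a free sum over [q]. *)
Lemma big_perm_split (A : Type) (idx : A) (op : Monoid.com_law idx) S x
    (F : {perm T} -> A) : x \in S ->
  \big[op/idx]_(s | perm_on S s) F s =
  \big[op/idx]_(c : {set T} | (x \in c) && (c \subset S))
    \big[op/idx]_(p | perm_on c p && (porbit p x == c))
      \big[op/idx]_(q | perm_on (S :\: c) q) F (p * q)%g.
Proof.
move=> xS; rewrite (partition_big (fun s => porbit s x)
   (fun c : {set T} => (x \in c) && (c \subset S))) /=; last first.
  by move=> s sS; rewrite porbit_id porbit_sub_on.
apply: eq_bigr => c /andP[xc cS].
rewrite (partition_big (fun s => restr_perm c s)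
  (fun p => perm_on c p && (porbit p x == c))) /=; last first.
  by move=> s /andP[sS /eqP <-]; have [-> ->] := restr_porbit s x; rewrite eqxx.
apply: eq_bigr => p /andP[pc /eqP px].
rewrite (reindex_inj (mulgI p)) /=; apply: eq_bigl => q.
by rewrite -(mulperm_blockP cS pc px) andbA.
Qed.

Variable w : nat -> R.

(** Keeping only cycles inside [S] discards the fixed points that a permutation supported on [S] has
    elsewhere. *)
Definition block_weight S s : R :=
  \big[Rmult/1]_(c in porbits s | c \subset S) w #|c|.

Lemma block_weight_mul S c x p q : c \subset S -> perm_on c p -> porbit p x = c ->
  perm_on (S :\: c) q ->
  block_weight S (p * q)%g = w #|c| * block_weight (S :\: c) q.
Proof.
move=> cS pc px qS; have xc : x \in c by rewrite -px porbit_id.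
rewrite /block_weight (bigD1 c) /=; last first.
  rewrite cS andbT; apply/imsetP; exists x => //.
  by rewrite (porbit_mulperm_in pc px qS).
congr (_ * _); apply: eq_bigl => d; apply/idP/idP.
- case/andP=> /andP[/imsetP[y _ ->] yS] ne.
  have yc : y \notin c.
    by apply: contra ne => yc; rewrite (porbit_mulperm_in pc px qS).
  rewrite (porbit_mulperm_out pc qS yc) in yS *.
  rewrite imset_f //=.
  have [ySc|ySc] := boolP (y \in S :\: c); first by rewrite porbit_sub_on.
  case/negP: ySc; rewrite inE yc /=; apply: (subsetP yS); exact: porbit_id.
case/andP=> /imsetP[y _ ->] yS.
have : y \in S :\: c by apply: (subsetP yS); exact: porbit_id.
rewrite inE => /andP[yc yS'].
rewrite -(porbit_mulperm_out pc qS yc) imset_f //=.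
rewrite (porbit_mulperm_out pc qS yc) (subset_trans yS) ?subsetDl //=.
apply/eqP=> E; have := porbit_id q y; rewrite E => yc'; by rewrite yc' in yc.
Qed.

End PermSplit.

(** * The law of the lexicographic cycle lengths *)

Lemma INR_factn_neq0 n : INR n`! <> 0.
Proof. by apply: not_0_INR => E; have := fact_gt0 n; rewrite E. Qed.

Lemma big_Rplus_const (I : finType) (P : pred I) (a : R) :
  \big[Rplus/0]_(i | P i) a = INR #|P| * a.
Proof.
rewrite big_const; elim: {P}#|P| => [|n IH]; first by rewrite /=; ring.
rewrite iterS IH S_INR; ring.
Qed.

(** * Sums over the permutations of a finite set *)

Section CycleSums.
Variable T : finType.
Implicit Types (s p q : {perm T}) (S c : {set T}) (x y : T).

Lemma sum_perm_on_const S (a : R) :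
  \big[Rplus/0]_(q | perm_on S q) a = INR #|S|`! * a.
Proof. by rewrite big_Rplus_const -card_perm; congr (INR _ * _); apply: eq_card. Qed.

Lemma sum_subsets_card S (G : nat -> R) :
  \big[Rplus/0]_(c : {set T} | c \subset S) G #|c| =
  \big[Rplus/0]_(i < #|S|.+1) (INR 'C(#|S|, i) * G i).
Proof.
rewrite (partition_big (fun c : {set T} => inord #|c| : 'I_#|S|.+1) predT) //=.
apply: eq_bigr => i _.
rewrite (eq_bigl (fun c => c \in [set A : {set T} | (A \subset S) && (#|A| == i)])); last first.
  move=> c; rewrite inE; case cS: (c \subset S) => //=.
  by rewrite -val_eqE /= inordK // ltnS subset_leq_card.
rewrite (eq_bigr (fun=> G i)); last by move=> c; rewrite inE => /andP[_ /eqP ->].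
by rewrite big_Rplus_const -cards_draws.
Qed.

(** With n = |S| - 1 there are C(n, i) sets of size i + 1, and C(n, i) i! (n - i)! = n! for every i:
    all lengths get the same factor. *)
Lemma sum_pointed_subsets S x (G : nat -> R) : x \in S ->
  \big[Rplus/0]_(c : {set T} | (x \in c) && (c \subset S))
     (INR (#|c|.-1)`! * (INR (#|S| - #|c|)`! * G #|c|)) =
  INR (#|S|.-1)`! * \big[Rplus/0]_(i < #|S|) G i.+1.
Proof.
move=> xS; have S0 : (0 < #|S|)%N by rewrite card_gt0; apply/set0Pn; exists x.
have -> : #|S| = (#|S :\ x|).+1 by rewrite (cardsD1 x S) xS.
set n := #|S :\ x|.
pose G' i := INR i`! * (INR (n - i)`! * G i.+1).
rewrite (reindex_onto (fun d : {set T} => x |: d) (fun c => c :\ x)) /=; last first.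
  by move=> c /andP[xc _]; rewrite setD1K.
rewrite (eq_big (fun d : {set T} => d \subset S :\ x) (fun d => G' #|d|)); last first.
- move=> d /andP[/andP[_ _] /eqP E].
  have xd : x \notin d by rewrite -E !inE eqxx.
  by rewrite cardsU1 xd /= add1n subSS.
- move=> d; rewrite setU11 /= subUset sub1set xS /=.
  rewrite subsetD1; case dS: (d \subset S) => //=.
  apply/eqP/idP => [<-|xd]; first by rewrite !inE eqxx.
  by rewrite setU1K.
rewrite sum_subsets_card -/n /= big_distrr /=; apply: eq_bigr => i _.
have le_in : (i <= n)%N by rewrite -ltnS.
rewrite /G' -(bin_fact le_in) !mult_INR; ring.
Qed.

(** Strong induction on |c|. The |c|! permutations of [c] are sorted by their cycle through [x]; by
    [sum_pointed_subsets] with G = 1, the total is the same when each subset [d] is credited with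
    (|d| - 1)! cycles. Proper subsets agree by induction, so the term d = c agrees too. *)
Lemma sum_cyclic_perms c x : x \in c ->
  \big[Rplus/0]_(p | perm_on c p && (porbit p x == c)) 1 = INR (#|c|.-1)`!.
Proof.
have [n] := ubnP #|c|; elim: n c => // n IH c; rewrite ltnS => cn xc.
have c0 : (0 < #|c|)%N by rewrite card_gt0; apply/set0Pn; exists x.
have := big_perm_split Rplus (fun=> 1) xc.
have := sum_pointed_subsets (fun=> 1) xc.
rewrite sum_perm_on_const (_ : \big[Rplus/0]_(i < #|c|) 1 = INR #|c| * 1); last first.
  rewrite big_Rplus_const -[in RHS](card_ord #|c|).
  by congr (INR _ * _); apply: eq_card.
have -> : INR (#|c|.-1)`! * (INR #|c| * 1) = INR #|c|`! * 1.
  by rewrite -[in RHS](prednK c0) factS mult_INR (prednK c0); ring.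
move=> <-; have P : (x \in c) && (c \subset c) by rewrite xc subxx.
rewrite (bigD1 c P) [in RHS](bigD1 c P) /= subnn.
rewrite (eq_bigr (fun d : {set T} =>
  \big[Rplus/0]_(p | perm_on d p && (porbit p x == d))
      \big[Rplus/0]_(q | perm_on (c :\: d) q) 1)); last first.
  move=> d /andP[/andP[xd dc] ne].
  have lt : (#|d| < #|c|)%N.
    by apply: proper_card; rewrite properEneq ne dc.
  rewrite -(IH d (leq_trans lt cn) xd) big_distrl /=.
  apply: eq_bigr => p _.
  by rewrite sum_perm_on_const cardsD (setIidPr dc); ring.
rewrite [in RHS](eq_bigr (fun=> 1)); last first.
  by move=> p _; rewrite sum_perm_on_const setDv cards0 /=; ring.
rewrite fact0 /=; lra.
Qed.

(** When the summand sees [p] only through its support, the choice of the cycle contributes just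
    (|c| - 1)!. *)
Lemma sum_perm_split S x (F : {perm T} -> R) (K : {set T} -> {perm T} -> R) :
  x \in S ->
  (forall c p q, c \subset S -> perm_on c p -> porbit p x = c ->
     perm_on (S :\: c) q -> F (p * q)%g = K c q) ->
  \big[Rplus/0]_(s | perm_on S s) F s =
  \big[Rplus/0]_(c : {set T} | (x \in c) && (c \subset S))
    (INR (#|c|.-1)`! * \big[Rplus/0]_(q | perm_on (S :\: c) q) K c q).
Proof.
move=> xS FK; rewrite (big_perm_split Rplus _ xS).
apply: eq_bigr => c /andP[xc cS].
rewrite -(sum_cyclic_perms xc) big_distrl /=.
apply: eq_bigr => p /andP[pc /eqP px].
by rewrite Rmult_1_l; apply: eq_bigr => q qS; apply: FK.
Qed.

Variables (w h : nat -> R) (M : nat).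
Hypotheses (h0 : h 0 = 1)
  (hrec : forall n, (0 < n <= M)%N ->
     INR n * h n = \big[Rplus/0]_(i < n) (w i.+1 * h (n - i.+1)%N)).

(** [hrec] is the coefficient form of z h'(z) = (sum_i w_i z^i) h(z), and removing the cycle through
    a point yields the same recursion. Stopping at [M] allows an [h] built from finitely many
    parts. *)
Lemma sum_block_weight S : (#|S| <= M)%N ->
  \big[Rplus/0]_(s | perm_on S s) block_weight w S s = INR #|S|`! * h #|S|.
Proof.
have [n] := ubnP #|S|; elim: n S => // n IH S; rewrite ltnS => Sn SM.
have [->|[x xS]] := set_0Vmem S.
  rewrite cards0 h0 (eq_bigr (fun=> 1)); last first.
    move=> s _; apply: big_pred0 => c; apply/andP=> -[/imsetP[y _ ->]].
    by move/subsetP/(_ _ (porbit_id s y)); rewrite inE.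
  by rewrite sum_perm_on_const cards0.
have S0 : (0 < #|S|)%N by rewrite card_gt0; apply/set0Pn; exists x.
rewrite (@sum_perm_split S x _
  (fun c q => w #|c| * block_weight w (S :\: c) q)) //; last first.
  by move=> c p q cS pc px qS; rewrite (block_weight_mul w cS pc px qS).
rewrite (eq_bigr (fun c : {set T} =>
  INR (#|c|.-1)`! * (INR (#|S| - #|c|)`! * (w #|c| * h (#|S| - #|c|)%N)))); last first.
  move=> c /andP[xc cS].
  have E : #|S :\: c| = (#|S| - #|c|)%N by rewrite cardsD (setIidPr cS).
  have c0 : (0 < #|c|)%N by rewrite card_gt0; apply/set0Pn; exists x.
  have lt : (#|S :\: c| < #|S|)%N.
    by rewrite E ltn_subrL c0 S0.
  rewrite -big_distrr /= IH ?E //; first ring.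
  - by rewrite -E (leq_trans lt).
  - by rewrite (leq_trans _ SM) // leq_subr.
rewrite (sum_pointed_subsets (fun k => w k * h (#|S| - k)%N) xS).
rewrite -hrec ?S0 // -[in RHS](prednK S0) factS mult_INR (prednK S0); ring.
Qed.

End CycleSums.

(** * Exploration of a permutation in lexicographic order *)

Section LexEvent.
Variable N : nat.
Implicit Types (s p q : {perm 'I_N}) (U c : {set 'I_N}).

Lemma first_out_notin U x : first_out U = Some x -> x \notin U.
Proof.
rewrite /first_out; case E: [seq _ <- _ | _] => [|y t] //= [<-].
have : y \in [seq x <- enum 'I_N | x \notin U] by rewrite E mem_head.
by rewrite mem_filter => /andP[].
Qed.

Lemma first_out_exists U : (0 < #|~: U|)%N -> exists x, first_out U = Some x.
Proof.
rewrite card_gt0 => /set0Pn[y]; rewrite inE => yU; rewrite /first_out.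
have : y \in [seq x <- enum 'I_N | x \notin U] by rewrite mem_filter yU mem_enum.
by case: [seq x <- enum 'I_N | x \notin U] => // z t _; exists z.
Qed.

Fixpoint lex_event U s (ls : seq nat) : bool :=
  if ls is l :: ls' then
    if first_out U is Some x then
      (#|porbit s x| == l) && lex_event (U :|: porbit s x) s ls'
    else false
  else true.

Lemma lex_eventE s (l : nat -> nat) m k :
  (forall i, (k < i <= k + m)%N -> (1 <= l i)%N) ->
  all (fun i => lexL s i == l i) (iota k.+1 m) =
  lex_event (lex_covered s k) s (map l (iota k.+1 m)).
Proof.
elim: m k => //= m IH k lpos.
have l1 : (1 <= l k.+1)%N by apply: lpos; rewrite ltnSn addnS ltnS leq_addr.
rewrite IH; last by move=> i /andP[ki ik]; apply: lpos; rewrite (ltnW ki) addnS.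
rewrite /=; case: (first_out _) => //.
(* With no point left, [lexL] has its default value 0, which differs from [l k.+1 >= 1]; this
   matches the [false] of [lex_event]. *)
by rewrite eq_sym; case: (l _) l1.
Qed.

Lemma lex_event_eq U s q ls :
  (forall y, y \notin U -> porbit s y = porbit q y) ->
  lex_event U s ls = lex_event U q ls.
Proof.
elim: ls U => //= l ls IH U H; case E: (first_out U) => [x|] //.
rewrite H ?(first_out_notin E) //; congr (_ && _); apply: IH => y.
by rewrite inE negb_or => /andP[/H].
Qed.

Variables (w h : nat -> R) (M : nat).
Hypotheses (h0 : h 0 = 1)
  (hrec : forall n, (0 < n <= M)%N ->
     INR n * h n = \big[Rplus/0]_(i < n) (w i.+1 * h (n - i.+1)%N)).

(** Unnormalized: with n points left, a cycle of length l through the least of them has factor w_l /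
    n; division by the initial [h n] gives the probability. *)
Fixpoint lex_prob (n : nat) (ls : seq nat) : R :=
  if ls is l :: ls' then w l / INR n * lex_prob (n - l) ls' else h n.

(** In the split along the cycle of the least free point only length [l] survives, and its factor (n
    - 1)! w_l is n! w_l / n. *)
Lemma sum_lex_event U ls : (#|~: U| <= M)%N -> all (leq 1) ls ->
  (sumn ls <= #|~: U|)%N ->
  \big[Rplus/0]_(s | perm_on (~: U) s)
     (if lex_event U s ls then block_weight w (~: U) s else 0) =
  INR #|~: U|`! * lex_prob #|~: U| ls.
Proof.
elim: ls U => [|l ls IH] U UM /=.
  by move=> _ _; exact: sum_block_weight h0 hrec _ UM.
case/andP=> l1 ls1 sU; set n := #|~: U| in UM sU *.
have ln : (l <= n)%N by apply: leq_trans sU; rewrite leq_addr.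
have n0 : (0 < n)%N by apply: leq_trans ln.
have [x Ex] := first_out_exists n0; rewrite Ex.
have xU : x \in ~: U by rewrite inE (first_out_notin Ex).
rewrite (@sum_perm_split _ (~: U) x _ (fun c q =>
  if #|c| == l then w l * (if lex_event (U :|: c) q ls then
     block_weight w (~: (U :|: c)) q else 0) else 0)) //; last first.
  move=> c p q cS pc px qS; have xc : x \in c by rewrite -px porbit_id.
  rewrite (porbit_mulperm_in pc px qS xc); case: eqP => [cl|] //=.
  rewrite -(@lex_event_eq _ (p * q)%g q); last first.
    move=> y; rewrite inE negb_or => /andP[_ yc].
    exact: (porbit_mulperm_out pc qS yc).
  case: ifP => _; last by ring.
  by rewrite (block_weight_mul w cS pc px qS) cl setDE -setCU.
rewrite (eq_bigr (fun c : {set 'I_N} =>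
  INR (#|c|.-1)`! * (INR (n - #|c|)`! *
    (if #|c| == l then w l * lex_prob (n - l) ls else 0)))); last first.
  move=> c /andP[xc cU]; congr (_ * _); rewrite setDE -setCU.
  case: eqP => [cl|_]; last by rewrite sum_perm_on_const; ring.
  have E : #|~: (U :|: c)| = (n - l)%N.
    by rewrite setCU -setDE cardsD (setIidPr cU) cl.
  rewrite -big_distrr /= IH // ?E ?cl; first ring.
  - by rewrite (leq_trans _ UM) // leq_subr.
  - by rewrite -(leq_add2l l) subnKC.
rewrite (sum_pointed_subsets
  (fun k => if k == l then w l * lex_prob (n - l) ls else 0) xU) -/n.
(* The index of the sum is the length minus one, so length [l] sits at [l.-1]. *)
have ln' : (l.-1 < n)%N by rewrite prednK.
rewrite (bigD1 (Ordinal ln')) //= prednK // eqxx big1; last first.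
  move=> i ne; case: eqP => // E; case/negP: ne; apply/eqP/val_inj.
  by rewrite /= -E.
rewrite -[in RHS](prednK n0) factS mult_INR (prednK n0).
have : INR n <> 0 by apply: not_0_INR => E; rewrite E in n0.
move=> ?; field; done.
Qed.

End LexEvent.

(** * From block weights to the measure *)

Section Probability.
Variables (theta kappa : nat -> R) (N : nat).
Let w (j : nat) := theta j + INR N * kappa j.

Lemma sumR_big (I : Type) (r : seq I) (F : I -> R) :
  sumR (map F r) = \big[Rplus/0]_(i <- r) F i.
Proof. by rewrite -(big_map F predT id) unlock /=; elim: r => //= a r ->. Qed.

Lemma prodR_big (I : Type) (r : seq I) (F : I -> R) :
  prodR (map F r) = \big[Rmult/1]_(i <- r) F i.
Proof. by rewrite -(big_map F predT id) unlock /=; elim: r => //= a r ->. Qed.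

Lemma weightE (s : {perm 'I_N}) :
  weight theta kappa s = block_weight w setT s.
Proof.
rewrite /weight prodR_big /block_weight.
rewrite (eq_bigl (fun c => c \in porbits s)); last by move=> c; rewrite subsetT andbT.
have szc c : c \in porbits s -> (0 < #|c| <= N)%N.
  case/imsetP=> x _ ->; rewrite lt0n card_porbit_neq0 /=.
  by rewrite -[X in (_ <= X)%N](card_ord N) max_card.
rewrite (partition_big (fun c : {set 'I_N} => inord #|c| : 'I_N.+1) predT) //=.
rewrite (_ : iota 1 N = index_iota 1 N.+1); last by rewrite /index_iota subn1.
(* Length 0 is a value of the sorting index, but no cycle is empty, so its factor is 1. *)
rewrite [in RHS]big_ord_recl [X in X * _]big_pred0 ?Rmult_1_l; last first.
  move=> c; case: (boolP (c \in porbits s)) => //= /szc/andP[c0 cN].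
  by rewrite -val_eqE /= inordK // eqn0Ngt c0.
rewrite big_add1 big_mkord; apply: eq_bigr => i _.
rewrite (eq_big (fun c => c \in [set c in porbits s | #|c| == i.+1])
   (fun=> theta i.+1 + INR N * kappa i.+1)); last first.
- move=> c /andP[cs /eqP/(congr1 val)] /=; case/andP: (szc c cs) => c0 cN.
  by rewrite inordK // => ->.
- move=> c; rewrite inE; case: (boolP (c \in porbits s)) => //= /szc/andP[c0 cN].
  by rewrite -val_eqE /= inordK.
rewrite big_const /cyc_count; elim: #|_| => //= k ->; done.
Qed.

Lemma fact_factn n : Factorial.fact n = n`!.
Proof. by elim: n => // n IH; rewrite factS -IH. Qed.

Lemma perm_onT (s : {perm 'I_N}) : perm_on setT s.
Proof. by apply/subsetP=> x _; rewrite inE. Qed.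

Variables (h : nat -> R).
Hypotheses (h0 : h 0 = 1)
  (hrec : forall n, (0 < n <= N)%N ->
     INR n * h n = \big[Rplus/0]_(i < n) (w i.+1 * h (n - i.+1)%N)).

Lemma HNE : HN theta kappa N = h N.
Proof.
rewrite /HN sumR_big big_enum /= (eq_bigr _ (fun s _ => weightE s)).
rewrite (eq_bigl (fun s => perm_on [set: 'I_N] s)); last first.
  by move=> s; rewrite perm_onT.
rewrite (sum_block_weight h0 hrec) cardsT card_ord // fact_factn.
by have := @INR_factn_neq0 N; move=> ?; field.
Qed.

Lemma PNevE m (l : nat -> nat) : h N <> 0 ->
  (forall i : nat, (1 <= i <= m)%N -> (1 <= l i)%N) ->
  (sumn (map l (iota 1 m)) <= N)%N ->
  @PNev theta kappa N
    (fun s : {perm 'I_N} => all (fun i => lexL s i == l i) (iota 1 m)) =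
  lex_prob w h N (map l (iota 1 m)) / h N.
Proof.
move=> hN lpos lN; rewrite /PNev sumR_big big_filter big_enum_cond /=.
have lpos' i : (0 < i <= 0 + m)%N -> (1 <= l i)%N by exact: lpos.
have E0 : (~: (set0 : {set 'I_N})) = setT by rewrite setC0.
have := @sum_lex_event N w h N h0 hrec set0 (map l (iota 1 m)).
rewrite E0 cardsT card_ord => /(_ (leqnn _)) H.
have {}H := H _ lN.
rewrite (eq_bigr (fun s => / (INR N`! * h N) * block_weight w setT s)); last first.
  move=> s _; rewrite /PN HNE fact_factn weightE; rewrite /Rdiv; ring.
rewrite -big_distrr /=.
rewrite big_mkcond /=.
rewrite (eq_big (fun s => perm_on [set: 'I_N] s) (fun s =>
  if lex_event set0 s (map l (iota 1 m)) then block_weight w setT s else 0)); last first.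
- by move=> s _; rewrite (lex_eventE s lpos').
- by move=> s; rewrite perm_onT.
rewrite H; last first.
  by apply/allP => k /mapP[i]; rewrite mem_iota => Hi ->; apply: lpos; rewrite add1n ltnS in Hi.
by have := @INR_factn_neq0 N; move=> ?; field.
Qed.

End Probability.

(** * Coefficients of exponentials *)

(** Coefficients of z^j a(z); the test keeps truncated subtraction from sending n < j to index 0. *)
Definition shift (j : nat) (a : nat -> R) (n : nat) : R :=
  if (j <= n)%N then a (n - j)%N else 0.

(** Coefficients of exp(lam z^j) a(z), [c] being the multiplicity of the part [j]; for j >= 1 the
    terms with c > n vanish. *)
Definition conv_exp (j : nat) (lam : R) (a : nat -> R) (n : nat) : R :=
  \big[Rplus/0]_(c < n.+1) (lam ^ c / INR c`! * shift (c * j) a n).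

(* exp_coef w J n is the coefficient of z^n in exp(sum_(j in J) w_j z^j / j). *)
Fixpoint exp_coef (w : nat -> R) (J : seq nat) : nat -> R :=
  if J is j :: J' then conv_exp j (w j / INR j) (exp_coef w J')
  else fun n => if n is 0%N then 1 else 0.

Section BigR.
Variables (I : Type) (r : seq I) (P : pred I).

Lemma big_Rplus_ge0 (F : I -> R) : (forall i, P i -> 0 <= F i) ->
  0 <= \big[Rplus/0]_(i <- r | P i) F i.
Proof. by move=> F0; elim/big_rec: _ => [|i x Pi x0]; have := F0; [lra|move/(_ i Pi); lra]. Qed.

Lemma big_Rplus_le (F G : I -> R) : (forall i, P i -> F i <= G i) ->
  \big[Rplus/0]_(i <- r | P i) F i <= \big[Rplus/0]_(i <- r | P i) G i.
Proof.
move=> FG; elim/big_rec2: _ => [|i x y Pi xy]; first lra.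
by have := FG i Pi; lra.
Qed.

End BigR.

Lemma big_Rplus_ge_term (I : eqType) (r : seq I) (F : I -> R) i :
  (forall k, k \in r -> 0 <= F k) -> i \in r -> F i <= \big[Rplus/0]_(k <- r) F k.
Proof.
elim: r => // k r IH F0; rewrite in_cons big_cons => /orP[/eqP ->|ir].
  suff : 0 <= \big[Rplus/0]_(k <- r) F k by lra.
  rewrite big_seq; apply: big_Rplus_ge0 => m mr; apply: F0.
  by rewrite in_cons mr orbT.
have := IH _ ir; have := F0 k (mem_head _ _).
have h m : m \in r -> 0 <= F m by move=> mr; apply: F0; rewrite in_cons mr orbT.
by move=> ? /(_ h); lra.
Qed.

Lemma INR_gt0 n : (0 < n)%N -> 0 < INR n.
Proof. by move/ltP; exact: lt_0_INR. Qed.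

Lemma INR_factn_gt0 n : 0 < INR n`!.
Proof. by apply: INR_gt0; exact: fact_gt0. Qed.

Lemma pow_exp (x : R) n : exp x ^ n = exp (INR n * x).
Proof.
elim: n => [|n IH]; first by rewrite Rmult_0_l exp_0.
by rewrite S_INR /= IH -exp_plus; congr exp; ring.
Qed.

Lemma shift_shift i j a n : shift i (shift j a) n = shift (i + j) a n.
Proof.
rewrite /shift; case: (leqP i n) => [le|lt].
  by rewrite leq_subRL // subnDA.
by rewrite leqNgt (leq_trans lt) // leq_addr.
Qed.

Lemma shift_ge0 j a n : (forall k, 0 <= a k) -> 0 <= shift j a n.
Proof. by move=> a0; rewrite /shift; case: ifP => _; [exact: a0|lra]. Qed.

Lemma shift_out j a n : (n < j)%N -> shift j a n = 0.
Proof. by rewrite /shift ltnNge => /negbTE ->. Qed.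

Lemma conv_exp_widen m j lam a n : (0 < j)%N -> (n < m)%N ->
  conv_exp j lam a n = \big[Rplus/0]_(c < m) (lam ^ c / INR c`! * shift (c * j) a n).
Proof.
move=> j0 nm; rewrite /conv_exp -!(big_mkord predT (fun c => lam ^ c / INR c`! * shift (c * j) a n)).
rewrite (big_cat_nat (n := n.+1) (p := m)) //= [X in _ + X]big_nat [X in _ + X]big1 ?Rplus_0_r //.
move=> c /andP[nc _]; rewrite shift_out; first ring.
by rewrite (leq_trans nc) // leq_pmulr.
Qed.

Lemma shift_conv_exp i j lam a n : (0 < j)%N ->
  shift i (conv_exp j lam a) n =
  \big[Rplus/0]_(c < n.+1) (lam ^ c / INR c`! * shift (c * j + i) a n).
Proof.
move=> j0; rewrite {1}/shift; case: (leqP i n) => [le|lt].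
  rewrite (@conv_exp_widen n.+1) ?ltnS ?leq_subr //.
  apply: eq_bigr => c _; congr (_ * _).
  by rewrite addnC -shift_shift [in RHS]/shift le.
rewrite big1 // => c _; rewrite shift_out; first ring.
by rewrite (leq_trans lt) // leq_addl.
Qed.

(** From c lam^c / c! = lam lam^(c-1) / (c-1)!. Divided by [conv_exp j lam a n], this is the mean
    multiplicity of [j]. *)
Lemma conv_exp_mean j lam a n : (0 < j)%N ->
  lam * shift j (conv_exp j lam a) n =
  \big[Rplus/0]_(c < n.+1) (INR c * (lam ^ c / INR c`! * shift (c * j) a n)).
Proof.
move=> j0; rewrite shift_conv_exp // big_ord_recr /= [in RHS]big_ord_recl.
rewrite [X in _ = X + _]Rmult_0_l [RHS]Rplus_0_l -mulSnr shift_out; last first.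
  by rewrite mulSn -add1n leq_add // leq_pmulr.
rewrite Rmult_0_r Rplus_0_r big_distrr /=; apply: eq_bigr => c _.
rewrite -[bump 0 c]/(c.+1) -mulSnr factS mult_INR.
have := INR_factn_gt0 c; have := INR_gt0 (ltn0Sn c).
by move=> ? ?; rewrite ?add0n -[X in _ = X * _]/(INR c.+1); field; lra.
Qed.

(** Coefficient form of z a'(z) = (sum_(i in J) w_i z^i) a(z) with a(0) = 1. *)
Definition exp_rec (w : nat -> R) (J : seq nat) (a : nat -> R) : Prop :=
  a 0%N = 1 /\
  forall n, INR n * a n = \big[Rplus/0]_(i <- J) (w i * shift i a n).

(** The new exponential factor adds w_j z^j to z a'/a. In coefficients, n = c j + (n - c j): the
    first summand is treated by [conv_exp_mean], the second by the recursion for [a]. *)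
Lemma exp_rec_conv w J j a : (0 < j)%N -> exp_rec w J a ->
  exp_rec w (j :: J) (conv_exp j (w j / INR j) a).
Proof.
move=> j0 [a0 arec]; have j0' := INR_gt0 j0; split.
  by rewrite /conv_exp big_ord1 /shift /= a0; field.
move=> n; rewrite big_cons; set lam := w j / INR j.
have -> : w j * shift j (conv_exp j lam a) n =
    INR j * (lam * shift j (conv_exp j lam a) n).
  by rewrite /lam; field; lra.
rewrite conv_exp_mean // (eq_bigr (fun i => \big[Rplus/0]_(c < n.+1)
   (lam ^ c / INR c`! * (w i * shift (c * j + i) a n)))); last first.
  by move=> i _; rewrite shift_conv_exp // big_distrr /=; apply: eq_bigr => c _; ring.
rewrite exchange_big /= !big_distrr /= -big_split /=; apply: eq_bigr => c _.
rewrite -big_distrr /=.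
have [cn|cn] := leqP (c * j) n; last first.
  rewrite big1 ?shift_out //; first ring.
  by move=> i _; rewrite shift_out ?Rmult_0_r // (leq_trans cn) // leq_addr.
rewrite (eq_bigr (fun i => w i * shift i a (n - c * j))); last first.
  by move=> i _; rewrite -shift_shift [shift (c * j) _ _]/shift cn.
rewrite -arec /shift cn minus_INR ?mult_INR; last exact/leP.
ring.
Qed.

Lemma exp_coef_rec w J : all (leq 1) J -> exp_rec w J (exp_coef w J).
Proof.
elim: J => [|j J IH] /=; last by case/andP=> j0 /IH; exact: exp_rec_conv.
by move=> _; split=> // -[|n]; rewrite big_nil /=; ring.
Qed.

(** Makes [exp_coef] independent of the order of the parts, so that any part can be moved to the
    front. *)
Lemma exp_rec_unique w J J' a b : all (leq 1) J -> perm_eq J J' ->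
  exp_rec w J a -> exp_rec w J' b -> a =1 b.
Proof.
move=> J0 JJ' [a0 arec] [b0 brec] n.
have [m] := ubnP n; elim: m n => // m IH n; rewrite ltnS => nm.
case: (posnP n) => [->|n0]; first by rewrite a0.
apply: (Rmult_eq_reg_l (INR n)); last by have := INR_gt0 n0; lra.
rewrite arec brec -(perm_big _ JJ') /= [LHS]big_seq [RHS]big_seq.
apply: eq_bigr => i iJ; congr (_ * _); rewrite /shift; case: ifP => // le.
by apply: IH; rewrite (leq_trans _ nm) // ltn_subrL (allP J0 i iJ).
Qed.

Lemma exp_coef_eq_in w w' J : {in J, w =1 w'} -> exp_coef w J =1 exp_coef w' J.
Proof.
elim: J => //= j J IH E n; rewrite E ?mem_head //.
apply: eq_bigr => c _; congr (_ * _); rewrite /shift; case: ifP => // _.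
by apply: IH => i iJ; apply: E; rewrite in_cons iJ orbT.
Qed.

(** * Upper and lower bounds on the coefficients *)

Section Bounds.
Variable w : nat -> R.
Hypothesis w0 : forall j, 0 <= w j.

Lemma weight_div_ge0 j : 0 <= w j / INR j.
Proof.
rewrite /Rdiv; case: j => [|j]; last first.
  by apply: Rmult_le_pos => //; apply/Rlt_le/Rinv_0_lt_compat/INR_gt0.
by rewrite /= Rinv_0; lra.
Qed.

Lemma pow_div_fact_ge0 (lam : R) c : 0 <= lam -> 0 <= lam ^ c / INR c`!.
Proof.
move=> l0; apply: Rmult_le_pos; first exact: pow_le.
by apply/Rlt_le/Rinv_0_lt_compat/INR_factn_gt0.
Qed.

Lemma exp_coef_ge0 J n : 0 <= exp_coef w J n.
Proof.
elim: J n => [[|n]|j J IH n] /=; try lra.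
apply: big_Rplus_ge0 => c _; apply: Rmult_le_pos; last exact: shift_ge0.
exact/pow_div_fact_ge0/weight_div_ge0.
Qed.

Lemma exp_partial_sum (x : R) n : 0 <= x ->
  \big[Rplus/0]_(c < n) (x ^ c / INR c`!) <= exp x.
Proof.
move=> x0; case: n => [|n]; first by rewrite big_ord0; exact/Rlt_le/exp_pos.
have -> : \big[Rplus/0]_(c < n.+1) (x ^ c / INR c`!) =
    sum_f_R0 (fun k => / INR (Factorial.fact k) * x ^ k) n.
  elim: n => [|n IH]; first by rewrite big_ord1 /=; field.
  by rewrite big_ord_recr tech5 IH fact_factn; congr (_ + _); exact: Rmult_comm.
apply: (@growing_ineq (fun n => sum_f_R0 (fun k => / INR (Factorial.fact k) * x ^ k) n)).
  move=> k /=; suff : 0 <= / INR (Factorial.fact k.+1) * x ^ k.+1 by rewrite /=; lra.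
  rewrite fact_factn Rmult_comm; exact: pow_div_fact_ge0.
by rewrite /exp; case: (exist_exp x).
Qed.

(** A nonnegative coefficient times r^n is at most the value of the series at r, here proved one
    exponential factor at a time. *)
Lemma exp_coef_upper J r n : all (leq 1) J -> 0 <= r ->
  exp_coef w J n * r ^ n <= exp (\big[Rplus/0]_(j <- J) (w j / INR j * r ^ j)).
Proof.
move=> J0 r0; elim: J J0 n => [|j J IH] /=.
  by move=> _ [|n]; rewrite big_nil exp_0 /=; lra.
case/andP=> j0 J0 n; rewrite big_cons exp_plus.
set B := exp (\big[Rplus/0]_(_ <- _) _) in IH *.
set x := w j / INR j * r ^ j.
have B0 : 0 <= B by exact/Rlt_le/exp_pos.
have lam0 := weight_div_ge0 j.
have x0 : 0 <= x by apply: Rmult_le_pos => //; exact: pow_le.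
apply: (Rle_trans _ ((\big[Rplus/0]_(c < n.+1) (x ^ c / INR c`!)) * B)); last first.
  by apply: Rmult_le_compat_r => //; exact: exp_partial_sum.
rewrite /conv_exp !big_distrl /=; apply: big_Rplus_le => c _.
rewrite /x Rpow_mult_distr -pow_mult /shift /Rdiv.
have c0 := pow_div_fact_ge0 c lam0; rewrite /Rdiv in c0.
have rc0 : 0 <= r ^ (j * c) by exact: pow_le.
case: leqP => cj; last first.
  have := Rmult_le_pos _ _ (Rmult_le_pos _ _ c0 rc0) B0.
  by congr (_ <= _); rewrite ?multE; ring.
have -> : r ^ n = r ^ (j * c) * r ^ (n - c * j).
  by rewrite -pow_add; congr (_ ^ _); rewrite mulnC; symmetry; exact: subnKC.
have := Rmult_le_compat_l _ _ _ (Rmult_le_pos _ _ c0 rc0) (IH J0 (n - c * j)%N).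
by congr (_ <= _); rewrite ?multE; ring.
Qed.

(** Among nonnegative terms, only the configuration with multiplicities [c] is kept. *)
Lemma exp_coef_lower J (c : nat -> nat) : all (leq 1) J ->
  \big[Rmult/1]_(j <- J) ((w j / INR j) ^ c j / INR (c j)`!) <=
  exp_coef w J (\sum_(j <- J) c j * j)%N.
Proof.
elim: J => [|j J IH] /=; first by rewrite !big_nil; lra.
case/andP=> j0 J0; rewrite !big_cons; set m := (\sum_(_ <- _) _)%N in IH *.
have cm : (c j < (c j * j + m).+1)%N by rewrite ltnS (leq_trans _ (leq_addr _ _)) // leq_pmulr.
have ge0 := pow_div_fact_ge0 (c j) (weight_div_ge0 j).
apply: Rle_trans (Rmult_le_compat_l _ _ _ ge0 (IH J0)) _.
have -> : exp_coef w J m = shift (c j * j) (exp_coef w J) (c j * j + m).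
  by rewrite /shift leq_addr addKn.
apply: (@big_Rplus_ge_term _ _ (fun c0 : 'I_(c j * j + m).+1 =>
  (w j / INR j) ^ c0 / INR c0`! * shift (c0 * j) (exp_coef w J) (c j * j + m)) (Ordinal cm)) => [k _|].
  apply: Rmult_le_pos; first exact/pow_div_fact_ge0/weight_div_ge0.
  by apply: shift_ge0 => i; exact: exp_coef_ge0.
by rewrite mem_index_enum.
Qed.

(** The configurations that avoid the additional parts are still counted: keep multiplicity 0 for
    each. *)
Lemma exp_coef_cat J1 J2 n : exp_coef w J1 n <= exp_coef w (J1 ++ J2) n.
Proof.
elim: J1 n => [|j J IH] n /=.
  elim: J2 n => [|j J2 IH] n /=; first lra.
  apply: Rle_trans (IH n) _.
  rewrite /conv_exp big_ord_recl /= mul0n /shift subn0 /=.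
  suff H : 0 <= \big[Rplus/0]_(i < n) ((w j / INR j) ^ bump 0 i / INR (bump 0 i)`! *
      (if (bump 0 i * j <= n)%N then exp_coef w J2 (n - bump 0 i * j) else 0)).
    by rewrite /= in H *; lra.
  apply: big_Rplus_ge0 => i _; apply: Rmult_le_pos.
    exact/pow_div_fact_ge0/weight_div_ge0.
  by case: ifP => _; [exact: exp_coef_ge0|lra].
apply: big_Rplus_le => c _; apply: Rmult_le_compat_l.
  exact/pow_div_fact_ge0/weight_div_ge0.
by rewrite /shift; case: ifP => _; [exact: IH|lra].
Qed.

Lemma exp_coef_step J j n : all (leq 1) J -> j \in J -> (j <= n)%N ->
  w j * exp_coef w J (n - j)%N <= INR n * exp_coef w J n.
Proof.
move=> J0 jJ jn; have [_ ->] := exp_coef_rec w J0.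
have := @big_Rplus_ge_term _ J (fun i => w i * shift i (exp_coef w J) n) j.
rewrite {2}/shift jn; apply => // k _; apply: Rmult_le_pos => //.
by apply: shift_ge0 => i; exact: exp_coef_ge0.
Qed.

Definition tilt (j : nat) (t : R) (i : nat) : R := if i == j then w i * exp t else w i.

(* Jensen's inequality for the multiplicity c of the part j: tilting the weight
   w_j by e^t multiplies a configuration by e^(tc), and the mean of c is
   (w_j / j) h_(n-j) / h_n. *)
Lemma exp_coef_tilt J j n t : all (leq 1) J -> uniq J -> j \in J -> (j <= n)%N ->
  0 < exp_coef w J n ->
  exp (t * (w j / INR j * (exp_coef w J (n - j)%N / exp_coef w J n))) *
    exp_coef w J n <= exp_coef (tilt j t) J n.
Proof.
move=> J0 Ju jJ jn; have j0 := allP J0 j jJ.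
have PJ := perm_to_rem jJ; have J0' : all (leq 1) (j :: rem j J).
  by rewrite -(perm_all _ PJ).
have E v : exp_coef v J =1 exp_coef v (j :: rem j J).
  exact: exp_rec_unique J0 PJ (exp_coef_rec v J0) (exp_coef_rec v J0').
have lamE := conv_exp_mean (w j / INR j) (exp_coef w (rem j J)) n j0.
rewrite {1}/shift jn in lamE.
rewrite !E /=; set u := exp_coef w (rem j J) in lamE *.
set lam := w j / INR j in lamE *.
set p := fun c : nat => lam ^ c / INR c`! * shift (c * j) u n.
have p0 c : 0 <= p c.
  apply: Rmult_le_pos; first exact/pow_div_fact_ge0/weight_div_ge0.
  by apply: shift_ge0 => i; exact: exp_coef_ge0.
have hE : conv_exp j lam u n = \big[Rplus/0]_(c < n.+1) p c by [].
move=> hn0; set m := lam * (_ / _).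
have mE : m * conv_exp j lam u n = \big[Rplus/0]_(c < n.+1) (INR c * p c).
  by rewrite -lamE /m; field; lra.
have -> : conv_exp j (tilt j t j / INR j) (exp_coef (tilt j t) (rem j J)) n =
    \big[Rplus/0]_(c < n.+1) (exp (t * INR c) * p c).
  apply: eq_bigr => c _; rewrite /tilt eqxx.
  have -> : w j * exp t / INR j = lam * exp t by rewrite /lam; field; have := INR_gt0 j0; lra.
  rewrite Rpow_mult_distr pow_exp (Rmult_comm _ t) /p.
  have -> : shift (c * j) (exp_coef (fun i => if i == j then w i * exp t else w i) (rem j J)) n = shift (c * j) u n.
    rewrite /shift; case: ifP => // _; apply: exp_coef_eq_in => i ij.
    by case: eqP ij => // ->; rewrite mem_rem_uniqF.
  by field; have := INR_factn_gt0 c; lra.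
(* Tangent line at the mean m: exp(t c) >= exp(t m) (1 + t (c - m)). Summed against [p], the linear
   term cancels. *)
apply: (Rle_trans _ (\big[Rplus/0]_(c < n.+1)
   (exp (t * m) * (1 - t * m) * p c + exp (t * m) * t * (INR c * p c)))).
  rewrite big_split /= -!big_distrr /= -hE -mE; right; ring.
apply: big_Rplus_le => c _.
have -> : exp (t * INR c) = exp (t * m) * exp (t * (INR c - m)).
  by rewrite -exp_plus; congr exp; ring.
have := exp_ineq1_le (t * (INR c - m)) => H.
have := Rmult_le_compat_l _ _ _ (Rlt_le _ _ (exp_pos (t * m))) H => H'.
have := Rmult_le_compat_r _ _ _ (p0 c) H'; lra.
Qed.

End Bounds.

(** * The ratio limit *)

Section NumericalSemigroup.
Variable A : nat -> Prop.

Inductive nat_span : nat -> Prop :=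
| nat_span0 : nat_span 0
| nat_spanD j s : A j -> nat_span s -> nat_span (j + s).

Lemma nat_span_add s t : nat_span s -> nat_span t -> nat_span (s + t).
Proof. by move=> Hs Ht; elim: Hs => // j s' Aj _ IH; rewrite -addnA; apply: nat_spanD. Qed.

Lemma nat_span_mul k s : nat_span s -> nat_span (k * s).
Proof.
by move=> Hs; elim: k => [|k IH]; [exact: nat_span0|rewrite mulSn; exact: nat_span_add].
Qed.

Hypothesis A_ge1 : forall j, A j -> (1 <= j)%N.
Hypothesis A_ex : exists j, A j.
Hypothesis A_gcd : ~ exists d, (1 < d)%N /\ forall j, A j -> (d %| j)%N.

(* Descent on the difference d: if d does not divide some a in A, then the
   remainder a mod d is a smaller positive difference of span elements. *)
Lemma nat_span_consecutive : exists b, (0 < b)%N /\ nat_span b /\ nat_span b.+1.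
Proof.
have [a0 Aa0] := A_ex.
have spanA a : A a -> nat_span a.
  by move=> Aa; rewrite -[a]addn0; apply: nat_spanD => //; exact: nat_span0.
suff [b [Hb Hb1]] : exists b, nat_span b /\ nat_span b.+1.
  exists (a0 + b)%N; split; first by rewrite ltn_addr // A_ge1.
  by rewrite -addnS; split; apply: nat_spanD.
have : exists d, (0 < d)%N /\ exists b, nat_span b /\ nat_span (b + d)%N.
  by exists a0; split; [exact: A_ge1|exists 0%N; split; [exact: nat_span0|exact: spanA]].
case=> d; have [n] := ubnP d; elim: n d => // n IH d; rewrite ltnS => dn [d0 [b [Hb Hbd]]].
case: (ltngtP d 1) => [|d1|d1]; first by rewrite ltnNge d0.
  have [[a [Aa nda]]|nA] := Classical_Prop.classic (exists a, A a /\ ~~ (d %| a)%N); last first.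
    case: A_gcd; exists d; split=> // j Aj.
    by apply/negPn/negP => nd; apply: nA; exists j.
  apply: (IH (a %% d)%N); first by rewrite (leq_trans _ dn) // ltn_mod.
  split; first by rewrite lt0n.
  (* With q = a / d rounded down, q (b + d) and q b + a are both in the span and differ by a mod
     d. *)
  exists (a %/ d * (b + d))%N; split; first exact: nat_span_mul.
  rewrite mulnDr -addnA -divn_eq; apply: nat_span_add; [exact: nat_span_mul|exact: spanA].
by exists b; rewrite -addn1 -d1.
Qed.

(** If s = q b + r with r < b <= q, then s = (q - r) b + r (b + 1). *)
Lemma nat_span_large : exists B, forall s, (B <= s)%N -> nat_span s.
Proof.
have [b [b0 [Hb Hb1]]] := nat_span_consecutive.
exists (b * b)%N => s Bs.
have qr : (s %% b <= s %/ b)%N.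
  by rewrite (leq_trans (ltnW (ltn_pmod s b0))) // leq_divRL.
have -> : s = ((s %/ b - s %% b) * b + (s %% b) * b.+1)%N.
  rewrite mulnBl mulnS addnCA addnBAC ?leq_mul2r ?qr ?orbT //.
  by rewrite addnK addnC -divn_eq.
by apply: nat_span_add; exact: nat_span_mul.
Qed.

End NumericalSemigroup.

(** * Elementary estimates for exponentials, logarithms and factorials *)

Lemma exp_le_quadratic t : t <= 1 / 2 -> exp t - 1 <= t + 2 * t ^ 2.
Proof.
move=> t2; have := exp_ineq1_le (- t); rewrite exp_Ropp => H.
have e0 := exp_pos t.
have H1 : exp t * (1 - t) <= 1.
  have := Rmult_le_compat_l _ _ _ (Rlt_le _ _ e0) H.
  by rewrite Rinv_r; lra.
have H2 : (1 + t + 2 * t ^ 2) * (1 - t) = 1 + t ^ 2 * (1 - 2 * t) by ring.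
have H3 : 0 <= t ^ 2 * (1 - 2 * t).
  by apply: Rmult_le_pos; [exact: pow2_ge_0|lra].
have : exp t * (1 - t) <= (1 + t + 2 * t ^ 2) * (1 - t) by lra.
by move/Rmult_le_reg_r => /(_ ltac:(lra)); lra.
Qed.

Lemma exp_le_compat x y : x <= y -> exp x <= exp y.
Proof. by case=> [/exp_increasing/Rlt_le|->]; [|exact: Rle_refl]. Qed.

Lemma ln_le_sub1 y : 0 < y -> ln y <= y - 1.
Proof. by move=> y0; have := exp_ineq1_le (ln y); rewrite exp_ln //; lra. Qed.

Lemma ln_sublinear C K d : 0 <= K -> 0 < d ->
  eventually (fun N => C + K * ln (INR N + 1) <= d * INR N).
Proof.
(* From ln(e (N + 1)) <= e (N + 1) - 1 with K e <= d / 2: half of d N pays for the slope, the other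
   half for the constants. *)
move=> K0 d0; set e := d / (2 * (K + 1)).
have e0 : 0 < e by apply: Rdiv_lt_0_compat; lra.
have Ke : K * e <= d / 2.
  have -> : d / 2 = (K + 1) * e by rewrite /e; field; lra.
  by lra.
have [N0 HN0] := INR_unbounded (2 / d * (C + K * (e - 1 - ln e))).
exists N0 => N /le_INR NN.
have N1 : 0 < INR N + 1 by have := pos_INR N; lra.
have := ln_le_sub1 (Rmult_lt_0_compat _ _ e0 N1); rewrite ln_mult // => H.
have H1 : K * ln (INR N + 1) <= K * (e * INR N + (e - 1 - ln e)).
  by apply: Rmult_le_compat_l => //; lra.
have H2 : K * e * INR N <= d / 2 * INR N.
  by apply: Rmult_le_compat_r => //; exact: pos_INR.
have H3 : C + K * (e - 1 - ln e) <= d / 2 * INR N.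
  have -> : C + K * (e - 1 - ln e) = d / 2 * (2 / d * (C + K * (e - 1 - ln e))).
    by field; lra.
  by apply: Rmult_le_compat_l; lra.
have E : K * (e * INR N + (e - 1 - ln e)) = K * e * INR N + K * (e - 1 - ln e) by ring.
by rewrite E in H1; lra.
Qed.

Lemma pow_self_succ c : INR c ^ c * exp (INR c / (INR c + 1)) <= (INR c + 1) ^ c.
Proof.
have c0 := pos_INR c.
have -> : INR c / (INR c + 1) = INR c * / (INR c + 1) by [].
rewrite -pow_exp -Rpow_mult_distr; apply: pow_incr; split.
  by apply: Rmult_le_pos => //; exact/Rlt_le/exp_pos.
have := exp_ineq1_le (- / (INR c + 1)); rewrite exp_Ropp.
set z := exp _ => H; have z0 : 0 < z by exact: exp_pos.
have E : (INR c + 1) * (1 + - / (INR c + 1)) = INR c by field; lra.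
have H1 : INR c <= (INR c + 1) * / z.
  by rewrite -{1}E; apply: Rmult_le_compat_l; lra.
have := Rmult_le_compat_r _ _ _ (Rlt_le _ _ z0) H1.
by rewrite Rmult_assoc Rinv_l; lra.
Qed.

(** A crude Stirling bound, c^c / c! >= e^(c-1) / (c+1)^2. Each induction step gains (c+1)^c / c^c
    >= e^(1 - 1/(c+1)), and 2 ln((c+2)/(c+1)) >= 1/(c+1) covers the deficit. *)
Lemma pow_div_fact_lower c x : INR c <= x ->
  exp (INR c - 1 - 2 * ln (INR c + 1)) <= x ^ c / INR c`!.
Proof.
move=> cx; apply: (Rle_trans _ (INR c ^ c / INR c`!)); last first.
  apply: Rmult_le_compat_r; first by apply/Rlt_le/Rinv_0_lt_compat/INR_factn_gt0.
  by apply: pow_incr; have := pos_INR c; lra.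
elim: c {x cx} => [|c IH].
  rewrite /= Rplus_0_l ln_1; have := exp_pos (0 - 1 - 2 * 0) => ?.
  have -> : 0 - 1 - 2 * 0 = - (1) by ring.
  rewrite exp_Ropp; have := exp_ineq1_le 1 => H.
  have : / exp 1 <= / 1 by apply: Rinv_le_contravar; lra.
  by lra.
have c0 := pos_INR c; have f0 := INR_factn_gt0 c.
have -> : INR c.+1 ^ c.+1 / INR (c.+1)`! = (INR c + 1) ^ c / INR c`!.
  by rewrite factS mult_INR -tech_pow_Rmult S_INR; field; lra.
apply: (Rle_trans _ (INR c ^ c / INR c`! * exp (INR c / (INR c + 1)))); last first.
  have := pow_self_succ c => /(Rmult_le_compat_r (/ INR c`!) _ _ (Rlt_le _ _ (Rinv_0_lt_compat _ f0))).
  by rewrite /Rdiv; lra.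
apply: Rle_trans (Rmult_le_compat_r _ _ _ (Rlt_le _ _ (exp_pos _)) IH).
rewrite -exp_plus S_INR; apply: exp_le_compat.
have H : ln (INR c + 1) - ln (INR c + 1 + 1) <= - / (INR c + 1 + 1).
  rewrite -ln_div; try lra.
  apply: Rle_trans (ln_le_sub1 _) _; first by apply: Rdiv_lt_0_compat; lra.
  by right; field; lra.
have H2 : / (INR c + 1) <= 2 * / (INR c + 1 + 1).
  apply: (Rmult_le_reg_r ((INR c + 1) * (INR c + 1 + 1))); first by apply: Rmult_lt_0_compat; lra.
  have -> : / (INR c + 1) * ((INR c + 1) * (INR c + 1 + 1)) = INR c + 1 + 1 by field; lra.
  have -> : 2 * / (INR c + 1 + 1) * ((INR c + 1) * (INR c + 1 + 1)) = 2 * (INR c + 1) by field; lra.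
  by lra.
have -> : INR c / (INR c + 1) = 1 - / (INR c + 1) by field; lra.
by lra.
Qed.

Lemma nat_floor x : 0 <= x -> {n : nat | INR n <= x < INR n + 1}.
Proof. by move=> x0; have [n Hn] := nfloor_ex x x0; exists n; lra. Qed.

(** * From the conditions on [rs] to the limit law *)

Section RatioLimit.
Variables (theta kappa : nat -> R) (rs : R).
Hypotheses (theta0 : forall j, 0 <= theta j) (kappa0 : forall j, 0 <= kappa j)
  (rs0 : 0 < rs).
Hypothesis mean_le1 :
  forall K, \big[Rplus/0]_(j <- iota 1 K) (kappa j * rs ^ j) <= 1.
Hypothesis mean_gt1 : forall r, rs < r ->
  exists K, 1 < \big[Rplus/0]_(j <- iota 1 K) (kappa j * r ^ j).
Hypothesis theta_bounded : forall r, 0 < r < rs ->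
  exists B, forall K, \big[Rplus/0]_(j <- iota 1 K) (theta j / INR j * r ^ j) <= B.
Hypothesis kappa_aperiodic : non_arithmetic kappa.
Hypothesis kappa_ex : exists j, (1 <= j)%N /\ 0 < kappa j.

Let w N j := theta j + INR N * kappa j.
(* For n <= 2 N this is h_n; the larger parts, left out here, do not matter. *)
Let H N n := exp_coef (w N) (iota 1 (2 * N)) n.
Let A j := (1 <= j)%N /\ 0 < kappa j.

Let w0 N j : 0 <= w N j.
Proof.
have := Rmult_le_pos _ _ (pos_INR N) (kappa0 j).
by have := theta0 j; rewrite /w; lra.
Qed.

Let iota_ge1 K : all (leq 1) (iota 1 K).
Proof. by apply/allP => j; rewrite mem_iota => /andP[]. Qed.

Let H0 N n : 0 <= H N n.
Proof. exact: exp_coef_ge0. Qed.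

Lemma big_iota_widen (F : nat -> R) K L : (K <= L)%N -> (forall j, 0 <= F j) ->
  \big[Rplus/0]_(j <- iota 1 K) F j <= \big[Rplus/0]_(j <- iota 1 L) F j.
Proof.
move=> KL F0; rewrite -(subnKC KL) iotaD big_cat /=.
have : 0 <= \big[Rplus/0]_(i <- iota (1 + K) (L - K)) F i by apply: big_Rplus_ge0.
by lra.
Qed.

Let A_span : exists B, forall s, (B <= s)%N -> nat_span A s.
Proof.
apply: nat_span_large; [by move=> j []|by []|].
case=> d [d1 Hd]; apply: kappa_aperiodic; exists d; split=> // j j1 kj.
by apply: Hd; split=> //; have := kappa0 j; lra.
Qed.

(** One term of the recursion gives w_j h_(n-j) <= n h_n. As w_j >= N kappa_j and n <= 2 N, each
    generator costs a factor kappa_j / 2, uniformly in N. *)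
Lemma span_lower s : nat_span A s -> exists c, 0 < c /\
  forall N n, (s <= n <= 2 * N)%N -> c * H N (n - s)%N <= H N n.
Proof.
elim=> [|j {}s [j1 kj] _ [c [c0 Hc]]].
  by exists 1; split=> [|N n _]; [lra|rewrite subn0; lra].
exists (c * (kappa j / 2)); split; first by apply: Rmult_lt_0_compat; lra.
move=> N n /andP[jsn nN].
have jn : (j <= n)%N by apply: leq_trans jsn; exact: leq_addr.
have sn : (s <= n - j)%N by rewrite leq_subRL.
have njN : (n - j <= 2 * N)%N by apply: leq_trans nN; exact: leq_subr.
have := Hc N (n - j)%N; rewrite sn njN -subnDA => /(_ isT) H1.
have jJ : j \in iota 1 (2 * N) by rewrite mem_iota j1 add1n ltnS (leq_trans jn).
have := exp_coef_step (w0 N) (iota_ge1 _) jJ jn; rewrite -!/(H _ _) => H2.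
have n0 : 0 < INR n by apply: INR_gt0; exact: leq_trans jn.
have nN' : INR n <= 2 * INR N by rewrite -[2]/(INR 2) -mult_INR; apply/le_INR/leP.
have H3 : INR N * kappa j * H N (n - j)%N <= INR n * H N n.
  apply: Rle_trans H2; apply: Rmult_le_compat_r; first exact: H0.
  by rewrite /w; have := theta0 j; lra.
have H4 : INR n * (kappa j / 2) * H N (n - j)%N <= INR N * kappa j * H N (n - j)%N.
  apply: Rmult_le_compat_r; first exact: H0.
  have := Rmult_le_compat_r (kappa j / 2) _ _ ltac:(lra) nN'; lra.
have H5 : kappa j / 2 * H N (n - j)%N <= H N n.
  by apply: (Rmult_le_reg_l (INR n)) => //; lra.
have := Rmult_le_compat_l (kappa j / 2) _ _ ltac:(lra) H1; lra.
Qed.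

(** A single constant for a window of shifts of any prescribed length, placed beyond the gaps of the
    span; it will absorb the rounding in [config_lower]. *)
Lemma span_lower_range : exists B, forall L, exists c, 0 < c /\
  forall N n s, (B <= s <= B + L)%N -> (s <= n <= 2 * N)%N ->
    c * H N (n - s)%N <= H N n.
Proof.
have [B HB] := A_span; exists B; elim=> [|L [c [c0 Hc]]].
  have [c [c0 Hc]] := span_lower (HB B (leqnn B)).
  exists c; split=> // N n s; rewrite addn0 -eqn_leq => /eqP <-; exact: Hc.
have [c' [c'0 Hc']] := span_lower (HB (B + L.+1)%N (leq_addr _ _)).
exists (Rmin c c'); split; first exact: Rmin_pos.
move=> N n s /andP[Bs sL] sn.
have [sL'|sL'] := leqP s (B + L).
  have := Hc N n s; rewrite Bs sL' => /(_ isT sn).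
  have := Rmult_le_compat_r _ _ _ (H0 N (n - s)) (Rmin_l c c'); lra.
have E : s = (B + L.+1)%N by apply/eqP; rewrite eqn_leq sL addnS.
rewrite -E in Hc'; have := Hc' N n sn.
have := Rmult_le_compat_r _ _ _ (H0 N (n - s)) (Rmin_r c c'); lra.
Qed.

(* The real g is g_kappa(rs), the supremum of its partial sums. *)
Lemma kappa_value : exists g, (forall K,
    \big[Rplus/0]_(j <- iota 1 K) (kappa j / INR j * rs ^ j) <= g) /\
  forall e, 0 < e -> exists K,
    g - e < \big[Rplus/0]_(j <- iota 1 K) (kappa j / INR j * rs ^ j).
Proof.
pose E x := exists K, x = \big[Rplus/0]_(j <- iota 1 K) (kappa j / INR j * rs ^ j).
have bE : bound E.
  exists 1 => x [K ->]; apply: Rle_trans (mean_le1 K).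
  rewrite !big_seq; apply: big_Rplus_le => j; rewrite mem_iota => /andP[j1 _].
  apply: Rmult_le_compat_r; first by apply: pow_le; lra.
  rewrite -{2}(Rmult_1_r (kappa j)); apply: Rmult_le_compat_l => //.
  rewrite -Rinv_1; apply: Rinv_le_contravar; first lra.
  by rewrite -[1]/(INR 1); apply/le_INR/leP.
have nE : exists x, E x by exists (\big[Rplus/0]_(j <- iota 1 0) (kappa j / INR j * rs ^ j)), 0%N.
have [g [ub lub]] := completeness E bE nE.
exists g; split=> [K|e e0]; first by apply: ub; exists K.
apply: Classical_Prop.NNPP => nK.
have : g <= g - e; last lra.
apply: lub => x [K ->]; apply: Rnot_lt_le => lt; apply: nK; by exists K.
Qed.

(** The truncated mean size is at most 1 at [rs] and exceeds 1 at [r], so a convex combination of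
    the two profiles has size exactly 1; it dominates the profile at [rs], whose sum is nearly
    [g]. *)
Lemma interpolate g r e :
  (forall e, 0 < e -> exists K,
    g - e < \big[Rplus/0]_(j <- iota 1 K) (kappa j / INR j * rs ^ j)) ->
  rs < r -> 0 < e -> exists K (y : nat -> R),
  [/\ forall j, 0 <= y j <= kappa j / INR j * r ^ j,
      \big[Rplus/0]_(j <- iota 1 K) (INR j * y j) = 1
    & g - e <= \big[Rplus/0]_(j <- iota 1 K) y j].
Proof.
move=> Hg rsr e0; have [K1 HK1] := mean_gt1 rsr; have [K2 HK2] := Hg e e0.
(* [K1] makes the size at [r] exceed 1, [K2] brings the sum at [rs] within [e] of [g]; enlarging the
   range preserves both. *)
set K := maxn K1 K2; exists K.
set S1 := \big[Rplus/0]_(j <- iota 1 K) (kappa j * rs ^ j).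
set S2 := \big[Rplus/0]_(j <- iota 1 K) (kappa j * r ^ j).
have S1le : S1 <= 1 by exact: mean_le1.
have S2gt : 1 < S2.
  apply: Rlt_le_trans HK1 _; apply: big_iota_widen; first exact: leq_maxl.
  by move=> j; apply: Rmult_le_pos => //; apply: pow_le; lra.
set t := (1 - S1) / (S2 - S1).
have t01 : 0 <= t <= 1.
  have i0 : 0 < / (S2 - S1) by apply: Rinv_0_lt_compat; lra.
  split; first by apply: Rmult_le_pos; lra.
  have := Rmult_le_compat_r (/ (S2 - S1)) (1 - S1) (S2 - S1) ltac:(lra) ltac:(lra).
  by rewrite Rinv_r /t /Rdiv; lra.
have k0 j : 0 <= kappa j / INR j by exact: weight_div_ge0.
have rr j : 0 <= rs ^ j <= r ^ j.
  by split; [apply: pow_le; lra|apply: pow_incr; lra].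
have xx j : 0 <= kappa j / INR j * rs ^ j <= kappa j / INR j * r ^ j.
  by split; [apply: Rmult_le_pos|apply: Rmult_le_compat_l]; have := rr j; try lra; move: (k0 j).
exists (fun j => (1 - t) * (kappa j / INR j * rs ^ j) + t * (kappa j / INR j * r ^ j)).
split.
- move=> j; have [x1 x2] := xx j.
  have T1 := Rmult_le_compat_l (1 - t) _ _ ltac:(lra) x2.
  have T2 := Rmult_le_compat_l t _ _ ltac:(lra) x2.
  have T3 := Rmult_le_compat_l (1 - t) _ _ ltac:(lra) x1.
  have T4 := Rmult_le_compat_l t _ _ ltac:(lra) x1.
  lra.
- rewrite (_ : \big[Rplus/0]_(_ <- _) _ = (1 - t) * S1 + t * S2); last first.
    rewrite /S1 /S2 !big_distrr /= -big_split /= big_seq [RHS]big_seq.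
    apply: eq_bigr => j; rewrite mem_iota => /andP[j1 _].
    by have := INR_gt0 j1 => ?; field; lra.
  by rewrite /t; field; lra.
apply: Rle_trans (Rlt_le _ _ HK2) _.
apply: Rle_trans (big_iota_widen (leq_maxr K1 K2) _) _; first by move=> j; case: (xx j).
apply: big_Rplus_le => j _; have [x1 x2] := xx j.
by have := Rmult_le_compat_l t _ _ ltac:(lra) x2; lra.
Qed.

(* Only the configuration with floor((N - D) y_j) parts j, for each j, is kept. *)
Lemma config_lower N D K r (y : nat -> R) : (0 < N)%N -> (D <= N)%N -> (K <= 2 * N)%N ->
  0 < r -> (forall j, 0 <= y j <= kappa j / INR j * r ^ j) ->
  \big[Rplus/0]_(j <- iota 1 K) (INR j * y j) = 1 ->
  exists m, [/\ (m <= N - D)%N, (N - D <= m + K * K)%N &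
    exp (INR (N - D) * \big[Rplus/0]_(j <- iota 1 K) y j - 2 * INR K
         - 2 * INR K * ln (INR N + 1) - INR m * ln r) <= H N m].
Proof.
move=> N0 DN KN r0 Hy y1; set n := (N - D)%N.
have ny j : 0 <= INR n * y j by apply: Rmult_le_pos; [exact: pos_INR|case: (Hy j)].
pose c j := sval (nat_floor (ny j)).
have Hc j : INR (c j) <= INR n * y j < INR (c j) + 1 by rewrite /c; case: (nat_floor _).
pose m := (\sum_(j <- iota 1 K) c j * j)%N.
have mE : INR m = \big[Rplus/0]_(j <- iota 1 K) (INR (c j) * INR j).
  rewrite /m; elim: (iota 1 K) => [|i s IH]; first by rewrite !big_nil.
  by rewrite !big_cons plus_INR mult_INR IH.
have constE (a : R) : \big[Rplus/0]_(j <- iota 1 K) a = INR K * a.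
  rewrite big_const_seq count_predT size_iota.
  by elim: (K) => [|k IH]; rewrite ?iterS ?IH ?S_INR /=; ring.
have mn : (m <= n)%N.
  apply/leP/INR_le; rewrite mE -(Rmult_1_r (INR n)) -y1 big_distrr /=.
  apply: big_Rplus_le => j _; have := Rmult_le_compat_r _ _ _ (pos_INR j) (proj1 (Hc j)).
  by lra.
(* Each of the K floors loses less than one part, of size at most K. *)
have nm : (n <= m + K * K)%N.
  apply/leP/INR_le; rewrite plus_INR mult_INR mE -(Rmult_1_r (INR n)) -y1 big_distrr /=.
  rewrite -(constE (INR K)) -big_split /= !big_seq; apply: big_Rplus_le => j.
  rewrite mem_iota add1n ltnS => /andP[_ jK].
  have := Rmult_le_compat_r _ _ _ (pos_INR j) (Rlt_le _ _ (proj2 (Hc j))).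
  by have : INR j <= INR K by [apply/le_INR/leP]; lra.
exists m; split=> //.
apply: (Rle_trans _ (exp_coef (w N) (iota 1 K) m)); last first.
  by rewrite /H -(subnKC KN) iotaD; exact: exp_coef_cat.
apply: Rle_trans _ (exp_coef_lower (w0 N) c (iota_ge1 K)).
(* [pow_div_fact_lower] costs 1 + 2 ln(c_j + 1) in the exponent and the floor at most 1 more, hence
   the constant 2; r^(-j c_j) compensates for using x = (w_j / j) r^j there. *)
apply: (Rle_trans _ (\big[Rmult/1]_(j <- iota 1 K)
   exp ((INR n * y j - 2 - 2 * ln (INR N + 1)) - INR (c j) * INR j * ln r))).
  rewrite -(big_morph exp exp_plus exp_0).
  rewrite [X in _ <= exp X](eq_bigr (fun j => INR n * y j + ((-2 - 2 * ln (INR N + 1)) +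
    (- ln r) * (INR (c j) * INR j)))); last by move=> j _; ring.
  rewrite !big_split /= -!big_distrr /= -mE !constE.
  by apply: exp_le_compat; lra.
rewrite big_seq [X in _ <= X]big_seq.
(* Nonnegativity is proved along with the inequality because the factors get multiplied. *)
apply: (proj2 (A := 0 <= \big[Rmult/1]_(j <- iota 1 K | j \in iota 1 K)
   exp ((INR n * y j - 2 - 2 * ln (INR N + 1)) - INR (c j) * INR j * ln r))).
apply: (big_ind2 (fun a b => 0 <= a <= b)); first lra.
  by move=> a a' b b' [? ?] [? ?]; split; [exact: Rmult_le_pos|exact: Rmult_le_compat].
move=> j jK; split; first exact/Rlt_le/exp_pos.
have j1 : (1 <= j)%N by move: jK; rewrite mem_iota => /andP[].
have j1' : 1 <= INR j by rewrite -[1]/(INR 1); apply/le_INR/leP.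
have yle : y j <= 1.
  have := @big_Rplus_ge_term _ (iota 1 K) (fun j => INR j * y j) j.
  rewrite y1 => /(_ _ jK) H1; have := Rmult_le_compat_r (y j) _ _ (proj1 (Hy j)) j1'.
  have : INR j * y j <= 1; last lra.
  by apply: H1 => k _; apply: Rmult_le_pos; [exact: pos_INR|case: (Hy k)].
have nN : INR n <= INR N by apply/le_INR/leP; exact: leq_subr.
have [c1 c2] := Hc j.
have cN : INR (c j) <= INR N.
  by have := Rmult_le_compat_l _ _ _ (pos_INR n) yle; lra.
have lnc : ln (INR (c j) + 1) <= ln (INR N + 1).
  by have := pos_INR (c j) => ?; apply: ln_le; lra.
have rj0 : 0 < r ^ j by exact: pow_lt.
have cx : INR (c j) <= w N j / INR j * r ^ j.
  apply: (Rle_trans _ (INR N * (kappa j / INR j * r ^ j))).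
    apply: Rle_trans c1 _; apply: Rmult_le_compat; try lra; [exact: pos_INR|by case: (Hy j)|by case: (Hy j)].
  rewrite -Rmult_assoc; apply: Rmult_le_compat_r; first lra.
  rewrite /Rdiv -Rmult_assoc; apply: Rmult_le_compat_r.
    by apply/Rlt_le/Rinv_0_lt_compat; lra.
  by have := theta0 j; rewrite /w; lra.
have := pow_div_fact_lower cx; rewrite Rpow_mult_distr -pow_mult => H1.
have rjc0 : 0 < r ^ (j * c j) by exact: pow_lt.
have rjcE : exp (INR (c j) * INR j * ln r) = r ^ (j * c j).
  by rewrite -[in RHS](exp_ln r r0) pow_exp mult_INR; congr exp; ring.
apply: (Rmult_le_reg_r (r ^ (j * c j))) => //.
rewrite -{1}rjcE -exp_plus.
have -> : (w N j / INR j) ^ c j / INR (c j)`! * r ^ (j * c j) =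
   (w N j / INR j) ^ c j * r ^ (j * c j) / INR (c j)`! by rewrite /Rdiv; ring.
by apply: Rle_trans H1; apply: exp_le_compat; lra.
Qed.
(** [config_lower] reaches some m within K^2 of N - D. With D = a + B the missing size N + b - a - m
    lies between B and B + b + K^2, where [span_lower_range] bridges it at the cost of a constant;
    all losses are o(N) and fit into e N / 2. *)
Lemma coef_lower_bound g e r a b :
  (forall e, 0 < e -> exists K,
    g - e < \big[Rplus/0]_(j <- iota 1 K) (kappa j / INR j * rs ^ j)) ->
  0 < e -> rs < r -> eventually (fun N =>
    exp (INR N * (g - e) - INR (N + b - a) * ln r) <= H N (N + b - a)).
Proof.
move=> Hg e0 rsr.
have [|K [y [Hy y1 yg]]] := @interpolate g r (e / 2) Hg rsr; first lra.
have [B HB] := span_lower_range; have [c [c0 Hc]] := HB (b + K * K)%N.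
set D := (a + B)%N; set L := (b + K * K)%N in Hc.
have Kpos : 0 <= 2 * INR K by have := pos_INR K; lra.
have He : 0 < e / 2 by lra.
have EV := ln_sublinear (- ln c + INR D * Rabs (g - e / 2) + 2 * INR K
  + INR (B + L) * Rabs (ln r)) Kpos He.
have EV2 : eventually (fun N => (D + K + b + 1 <= N)%N).
  by exists (D + K + b + 1)%N => N /leP.
apply: filter_imp (filter_and _ _ EV EV2) => N [H1 H2].
have [||||m [m1 m2 m3]] := @config_lower N D K r y _ _ _ _ Hy y1; try lia; first lra.
set n := (N + b - a)%N.
have sB : (B <= n - m <= B + L)%N by rewrite /n /L; move: m1 m2; rewrite /D; lia.
have mn : (m <= n)%N by rewrite /n; move: m1; rewrite /D; lia.
have := Hc N n (n - m)%N sB; rewrite leq_subr /= subKn // => /(_ ltac:(rewrite /n; lia)).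
apply: Rle_trans; apply: Rle_trans (Rmult_le_compat_l _ _ _ (Rlt_le _ _ c0) m3).
rewrite -{1}(exp_ln c c0) -exp_plus; apply: exp_le_compat.
have DN : (D <= N)%N by lia.
have E1 : INR (N - D) = INR N - INR D by rewrite minus_INR //; exact/leP.
have E2 : INR n = INR m + INR (n - m) by rewrite -plus_INR; congr INR; lia.
have T1 := Rmult_le_compat_l _ _ _ (pos_INR (N - D)) yg.
have T2 := Rmult_le_compat_l _ _ _ (pos_INR D) (Rle_abs (g - e / 2)).
have T3 : - (INR (n - m) * ln r) <= INR (B + L) * Rabs (ln r).
  apply: (Rle_trans _ (INR (n - m) * Rabs (ln r))).
    have := Rmult_le_compat_l _ _ _ (pos_INR (n - m)) (Rle_abs (- ln r)).
    by rewrite Rabs_Ropp; lra.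
  apply: Rmult_le_compat_r; first exact: Rabs_pos.
  by apply/le_INR/leP; case/andP: sB.
by rewrite E2; rewrite E1 in T1 *; lra.
Qed.

Lemma coef_pos a b : eventually (fun N => 0 < H N (N + b - a)).
Proof.
have [g [_ Hg]] := kappa_value.
have rs2 : rs < 2 * rs by lra.
have E := coef_lower_bound a b Hg Rlt_0_1 rs2.
by apply: filter_imp E => N; apply: Rlt_le_trans; exact: exp_pos.
Qed.

Lemma sum_tilt v j t r J : j \in J -> uniq J ->
  \big[Rplus/0]_(i <- J) (tilt v j t i / INR i * r ^ i) =
  \big[Rplus/0]_(i <- J) (v i / INR i * r ^ i) + v j / INR j * (exp t - 1) * r ^ j.
Proof.
move=> jJ Ju; rewrite !(perm_big _ (perm_to_rem jJ)) /= !big_cons {1}/tilt eqxx.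
have -> : \big[Rplus/0]_(i <- rem j J) (tilt v j t i / INR i * r ^ i) =
    \big[Rplus/0]_(i <- rem j J) (v i / INR i * r ^ i).
  rewrite big_seq [RHS]big_seq; apply: eq_bigr => i ij.
  by rewrite /tilt; case: (i =P j) => // E; rewrite E mem_rem_uniqF in ij.
by rewrite /Rdiv /=; ring.
Qed.

(** An upper bound on the ratio for t > 0, a lower bound for t < 0. Jensen's inequality is combined
    with [exp_coef_upper] at r < rs and [coef_lower_bound] at r' > rs; after logarithms N g cancels,
    and one divides by lam >= N k. *)
Lemma tilted_ratio_bound j t eta a b : (1 <= j)%N -> 0 < kappa j ->
  -1 / 2 <= t <= 1 / 2 -> 0 < eta ->
  eventually (fun N => t * (H N (N + b - a - j) / H N (N + b - a)) <=
    eta + (t + 2 * t ^ 2) * rs ^ j).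
Proof.
move=> j1 kj t2 eta0; have [g [Hg1 Hg2]] := kappa_value.
have j0 : 0 < INR j by exact: INR_gt0.
set k := kappa j / INR j; have k0 : 0 < k by exact: Rdiv_lt_0_compat.
have rsj0 : 0 < rs ^ j by exact: pow_lt.
(* The first bound controls n (ln r' - ln r) = 2 d n <= 4 d N, the second gives rs^j - r^j <= eta /
   4. *)
set d := Rmin (eta * k / 32) (eta / (4 * INR j * rs ^ j)).
have d0 : 0 < d.
  apply: Rmin_pos; first by apply: Rdiv_lt_0_compat; [apply: Rmult_lt_0_compat|lra].
  by apply: Rdiv_lt_0_compat => //; apply: Rmult_lt_0_compat => //; lra.
have d1 : 4 * d <= eta * k / 8 by have := Rmin_l (eta * k / 32) (eta / (4 * INR j * rs ^ j)); rewrite -/d; lra.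
have d2 : INR j * d * rs ^ j <= eta / 4.
  have := Rmult_le_compat_l (INR j * rs ^ j) _ _ (Rlt_le _ _ (Rmult_lt_0_compat _ _ j0 rsj0))
    (Rmin_r (eta * k / 32) (eta / (4 * INR j * rs ^ j))).
  rewrite -/d; have -> : INR j * rs ^ j * (eta / (4 * INR j * rs ^ j)) = eta / 4 by field; lra.
  by lra.
set r := rs * exp (- d); set r' := rs * exp d.
have ed := exp_pos d; have emd := exp_pos (- d).
have r0 : 0 < r by exact: Rmult_lt_0_compat.
have rrs : r < rs.
  have : exp (- d) < 1 by rewrite -exp_0; apply: exp_increasing; lra.
  by move/(Rmult_lt_compat_l rs _ _ rs0); rewrite -/r; lra.
have rsr' : rs < r'.
  have : 1 < exp d by rewrite -exp_0; apply: exp_increasing; lra.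
  by move/(Rmult_lt_compat_l rs _ _ rs0); rewrite -/r'; lra.
have lnr : ln r = ln rs - d by rewrite /r ln_mult // ln_exp; ring.
have lnr' : ln r' = ln rs + d by rewrite /r' ln_mult // ln_exp; ring.
have rjle : r ^ j <= rs ^ j by apply: pow_incr; lra.
have rjge : rs ^ j - eta / 4 <= r ^ j.
  rewrite /r Rpow_mult_distr pow_exp.
  have := exp_ineq1_le (INR j * - d) => /(Rmult_le_compat_l _ _ _ (Rlt_le _ _ rsj0)); lra.
have [B0 HB0] := theta_bounded (conj r0 rrs); set B := Rmax B0 0.
set e := eta * k / 8; have e0 : 0 < e by apply: Rdiv_lt_0_compat; [exact: Rmult_lt_0_compat|lra].
have EV := coef_lower_bound a b Hg2 e0 rsr'.
have [M HM] := INR_unbounded (4 * B / (eta * k)).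
have EV2 : eventually (fun N => (M + a + b + j + 1 <= N)%N).
  by exists (M + a + b + j + 1)%N => N /leP.
apply: filter_imp (filter_and _ _ EV EV2) => N [Hlow HN].
set n := (N + b - a)%N in Hlow *; set x := H N (n - j) / H N n.
have N0 : 0 < INR N by apply: INR_gt0; lia.
have hn0 : 0 < H N n by apply: Rlt_le_trans Hlow; exact: exp_pos.
have jJ : j \in iota 1 (2 * N) by rewrite mem_iota; lia.
have jn : (j <= n)%N by rewrite /n; lia.
set lam := w N j / INR j.
have lamge : INR N * k <= lam.
  rewrite /lam /k /Rdiv -Rmult_assoc; apply: Rmult_le_compat_r.
    by apply/Rlt_le/Rinv_0_lt_compat.
  by have := theta0 j; rewrite /w; lra.
have Nk0 : 0 < INR N * k by exact: Rmult_lt_0_compat.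
have lam0 : 0 < lam by lra.
have tilt0 i : 0 <= tilt (w N) j t i.
  rewrite /tilt; case: ifP => _ //; apply: Rmult_le_pos => //; exact/Rlt_le/exp_pos.
have J1 := @exp_coef_tilt _ (w0 N) _ j n t (iota_ge1 (2 * N)) (iota_uniq _ _) jJ jn hn0.
rewrite -!/(H N _) -/x -/lam in J1.
have J2 := exp_coef_upper tilt0 n (iota_ge1 (2 * N)) (Rlt_le _ _ r0).
rewrite sum_tilt ?iota_uniq // -/lam in J2.
have S1 : \big[Rplus/0]_(i <- iota 1 (2 * N)) (w N i / INR i * r ^ i) <= B + INR N * g.
  rewrite (eq_bigr (fun i => theta i / INR i * r ^ i + INR N * (kappa i / INR i * r ^ i))); last first.
    by move=> i _; rewrite /w /Rdiv; ring.
  rewrite big_split /= -big_distrr /=.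
  have T1 := HB0 (2 * N)%N; have T2 := Rmax_l B0 0.
  have T3 : \big[Rplus/0]_(i <- iota 1 (2 * N)) (kappa i / INR i * r ^ i) <= g.
    apply: Rle_trans (Hg1 (2 * N)%N); apply: big_Rplus_le => i _.
    apply: Rmult_le_compat_l; first exact: weight_div_ge0.
    by apply: pow_incr; lra.
  by have := Rmult_le_compat_l _ _ _ (pos_INR N) T3; rewrite -/B in T2; lra.
have rn : r ^ n = exp (INR n * ln r) by rewrite -{1}(exp_ln r r0) pow_exp.
have rn0 : 0 < r ^ n by exact: pow_lt.
have J3 : exp (t * (lam * x)) * exp (INR N * (g - e) - INR n * ln r') * r ^ n <=
    exp (B + INR N * g + lam * (exp t - 1) * r ^ j).
  apply: (Rle_trans _ (exp (t * (lam * x)) * H N n * r ^ n)).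
    apply: Rmult_le_compat_r; first lra.
    by apply: Rmult_le_compat_l => //; exact/Rlt_le/exp_pos.
  apply: Rle_trans (Rmult_le_compat_r _ _ _ (Rlt_le _ _ rn0) J1) _.
  by apply: Rle_trans J2 _; apply: exp_le_compat; exact: Rplus_le_compat_r.
rewrite rn -!exp_plus in J3.
have J4 : t * (lam * x) + (INR N * (g - e) - INR n * ln r') + INR n * ln r <=
    B + INR N * g + lam * (exp t - 1) * r ^ j.
  by apply: Rnot_lt_le => /exp_increasing; lra.
have n2N : INR n <= 2 * INR N.
  by rewrite -[2]/(INR 2) -mult_INR; apply/le_INR; rewrite /n; lia.
(* The loss [e] and the gap between r and r' each cost at most eta k / 8 per unit of N. *)
have J5 : lam * (t * x) <= B + INR N * (eta * k / 4) + lam * ((exp t - 1) * r ^ j).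
  have T := Rmult_le_compat_r (2 * d) _ _ ltac:(lra) n2N.
  have T' := Rmult_le_compat_l _ _ _ (pos_INR N) d1.
  rewrite lnr lnr' in J4; rewrite /e in J4; lra.
have B1 : B <= eta / 4 * (INR N * k).
  have NM : INR M <= INR N by apply/le_INR; lia.
  have -> : B = eta * k / 4 * (4 * B / (eta * k)) by field; lra.
  have -> : eta / 4 * (INR N * k) = eta * k / 4 * INR N by field.
  apply: Rmult_le_compat_l; last lra.
  by have := Rmult_lt_0_compat _ _ eta0 k0; lra.
have J6 : lam * (t * x) <= lam * (eta / 2 + (exp t - 1) * r ^ j).
  by have := Rmult_le_compat_l (eta / 2) _ _ ltac:(lra) lamge; lra.
have J7 := Rmult_le_reg_l _ _ _ lam0 J6.
have et := @exp_le_quadratic t (proj2 t2).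
have rj0 : 0 <= r ^ j by apply: pow_le; lra.
have J8 := Rmult_le_compat_r _ _ _ rj0 et.
have q1 : -1 <= t + 2 * t ^ 2 <= 1 by nra.
(* The sign of t + 2 t^2 decides whether r^j <= rs^j or rs^j - eta / 4 <= r^j is used. *)
have J9 : (t + 2 * t ^ 2) * (r ^ j - rs ^ j) <= eta / 4.
  have [le|ge] := Rle_lt_dec 0 (t + 2 * t ^ 2).
    have := Rmult_le_compat_l _ _ _ le rjle; lra.
  have := Rmult_le_compat_neg_l (t + 2 * t ^ 2) (- (eta / 4)) (r ^ j - rs ^ j) ltac:(lra) ltac:(lra).
  have := Rmult_le_compat_r (eta / 4) _ _ ltac:(lra) (proj1 q1); lra.
lra.
Qed.

Lemma ratio_limit_part j a b : (1 <= j)%N -> 0 < kappa j ->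
  is_lim_seq (fun N => H N (N + b - a - j) / H N (N + b - a)) (rs ^ j).
Proof.
move=> j1 kj; apply/is_lim_seq_spec => e.
have e0 := cond_pos e; have rsj0 : 0 < rs ^ j by exact: pow_lt.
(* The bounds for t and -t with eta = t e / 4, divided by t, enclose the ratio within 2 t rs^j + e /
   4 of rs^j; this t makes 2 t rs^j <= e / 4. *)
set t := Rmin (1 / 2) (e / (8 * rs ^ j)).
have t0 : 0 < t by apply: Rmin_pos; [lra|apply: Rdiv_lt_0_compat; lra].
have t1 : t <= 1 / 2 by exact: Rmin_l.
have t2 : t * rs ^ j <= e / 8.
  have := Rmult_le_compat_r _ _ _ (Rlt_le _ _ rsj0) (Rmin_r (1 / 2) (e / (8 * rs ^ j))).
  by have -> : e / (8 * rs ^ j) * rs ^ j = e / 8 by field; lra.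
have te0 : 0 < t * e / 4 by have := Rmult_lt_0_compat _ _ t0 e0; lra.
have E1 := @tilted_ratio_bound j t _ a b j1 kj ltac:(lra) te0.
have E2 := @tilted_ratio_bound j (- t) _ a b j1 kj ltac:(lra) te0.
apply: filter_imp (filter_and _ _ E1 E2) => N [].
set x := _ / _ => H1 H2.
have U : t * x <= t * (e / 4 + (1 + 2 * t) * rs ^ j) by lra.
have L : t * ((1 - 2 * t) * rs ^ j - e / 4) <= t * x by lra.
have {}U := Rmult_le_reg_l _ _ _ t0 U; have {}L := Rmult_le_reg_l _ _ _ t0 L.
by apply: Rabs_def1; lra.
Qed.

(** Telescoping over the generators of [s]; [a] varies in the induction since removing a part j
    moves the base point to a + j. *)
Lemma ratio_limit_span s a b : nat_span A s ->
  is_lim_seq (fun N => H N (N + b - a - s) / H N (N + b - a)) (rs ^ s).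
Proof.
move=> Hs; elim: Hs a => [|j {}s [j1 kj] _ IH] a.
  apply: (is_lim_seq_ext_loc (fun=> 1)); last exact: is_lim_seq_const.
  by apply: filter_imp (coef_pos a b) => N h0; rewrite subn0; field; lra.
rewrite pow_add Rmult_comm.
apply: (is_lim_seq_ext_loc (fun N => H N (N + b - (a + j) - s) / H N (N + b - (a + j)) *
   (H N (N + b - a - j) / H N (N + b - a)))); last first.
  by apply: is_lim_seq_mult'; [exact: IH|exact: ratio_limit_part].
apply: filter_imp (filter_and _ _ (coef_pos a b) (coef_pos (a + j) b)) => N [h1 h2].
by rewrite !subnDA in h2 *; field; lra.
Qed.

(** For consecutive span elements s and s + 1, divide the two ratio limits at n = N + s - c: what
    remains is h_(N-c-1) / h_(N-c), with limit rs. The offset [b] of the earlier lemmas serves here,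
    with b = s. *)
Lemma ratio_limit a : is_lim_seq (fun N => H N (N - a) / H N N) (rs ^ a).
Proof.
have A1 j : A j -> (1 <= j)%N by case.
have A2 : ~ exists d, (1 < d)%N /\ forall j, A j -> (d %| j)%N.
  case=> d [d1 Hd]; apply: kappa_aperiodic; exists d; split=> // j j1 kj.
  by apply: Hd; split=> //; have := kappa0 j; lra.
have [s [_ [Hs Hs1]]] := nat_span_consecutive A1 kappa_ex A2.
have step c : is_lim_seq (fun N => H N (N - c.+1) / H N (N - c)) rs.
  have L1 := ratio_limit_span c s Hs1; have L0 := ratio_limit_span c s Hs.
  have rs_s : rs ^ s <> 0 by apply: pow_nonzero; lra.
  have := is_lim_seq_div' _ _ _ _ L1 L0 rs_s.
  have -> : rs ^ s.+1 / rs ^ s = rs by rewrite /=; field.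
  apply: is_lim_seq_ext_loc.
  have EV : eventually (fun N => (c + 1 <= N)%N) by exists (c + 1)%N => N /leP.
  apply: filter_imp (filter_and _ _ EV (filter_and _ _ (coef_pos c 0) (coef_pos c s))).
  move=> N [cN [h0 h1]]; rewrite addn0 in h0.
  have -> : (N + s - c - s.+1 = N - c.+1)%N by lia.
  have -> : (N + s - c - s = N - c)%N by lia.
  by field; lra.
elim: a => [|a IH].
  apply: (is_lim_seq_ext_loc (fun=> 1)); last exact: is_lim_seq_const.
  apply: filter_imp (coef_pos 0 0) => N; rewrite addn0 subn0 => h0; by field; lra.
rewrite /=.
apply: (is_lim_seq_ext_loc (fun N => H N (N - a.+1) / H N (N - a) * (H N (N - a) / H N N))).
  apply: filter_imp (filter_and _ _ (coef_pos 0 0) (coef_pos a 0)) => N.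
  by rewrite !addn0 subn0 => -[h1 h2]; field; lra.
exact: is_lim_seq_mult'.
Qed.

Lemma lex_prob_limit ls a :
  is_lim_seq (fun N => lex_prob (w N) (H N) (N - a) ls / H N N)
    (rs ^ a * \big[Rmult/1]_(l <- ls) (kappa l * rs ^ l)).
Proof.
elim: ls a => [|l ls IH] a /=.
  by rewrite big_nil Rmult_1_r; exact: ratio_limit.
have Lw : is_lim_seq (fun N => w N l / INR (N - a)) (kappa l).
  have LN : is_lim_seq (fun N => / INR N) 0.
    by apply: (is_lim_seq_inv _ p_infty); [exact: is_lim_seq_INR|].
  have Lz : is_lim_seq (fun N => (theta l * / INR N + kappa l) / (1 - INR a * / INR N))
     ((theta l * 0 + kappa l) / (1 - INR a * 0)).
    apply: is_lim_seq_div'; last lra.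
      apply: is_lim_seq_plus'; last exact: is_lim_seq_const.
      by apply: is_lim_seq_mult' => //; exact: is_lim_seq_const.
    apply: is_lim_seq_minus'; first exact: is_lim_seq_const.
    by apply: is_lim_seq_mult' => //; exact: is_lim_seq_const.
  have E : (theta l * 0 + kappa l) / (1 - INR a * 0) = kappa l by field; lra.
  rewrite E in Lz; apply: is_lim_seq_ext_loc Lz.
  exists (a + 1)%N => N aN; rewrite /w minus_INR; last lia.
  have : INR a + 1 <= INR N by rewrite -S_INR; apply: le_INR; lia.
  by have := pos_INR a => ? ?; field; lra.
have := is_lim_seq_mult' _ _ _ _ Lw (IH (a + l)%N).
have -> : kappa l * (rs ^ (a + l) * \big[Rmult/1]_(i <- ls) (kappa i * rs ^ i)) =
   rs ^ a * \big[Rmult/1]_(i <- l :: ls) (kappa i * rs ^ i).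
  by rewrite big_cons pow_add; ring.
apply: is_lim_seq_ext => N; rewrite subnDA /Rdiv; ring.
Qed.

Lemma PNev_limit m (l : nat -> nat) :
  (forall i : nat, (1 <= i <= m)%N -> (1 <= l i)%N) ->
  is_lim_seq
    (fun N : nat => @PNev theta kappa N
       (fun s : {perm 'I_N} => all (fun i => lexL s i == l i) (iota 1 m)))
    (\big[Rmult/1]_(i <- iota 1 m) (kappa (l i) * rs ^ (l i))).
Proof.
move=> lpos; have := @lex_prob_limit (map l (iota 1 m)) 0.
rewrite big_map Rmult_1_l; apply: is_lim_seq_ext_loc.
have EV : eventually (fun N => (sumn (map l (iota 1 m)) <= N)%N).
  by exists (sumn (map l (iota 1 m))) => N /leP.
apply: filter_imp (filter_and _ _ EV (coef_pos 0 0)) => N [lN].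
rewrite addn0 !subn0 => hN.
have [h0 hrec] := exp_coef_rec (w N) (iota_ge1 (2 * N)).
symmetry; apply: (@PNevE theta kappa N (H N) h0) => //; last lra.
move=> n /andP[n0 nN]; rewrite hrec -/(H N).
(* For n <= N the parts above n contribute nothing, so the truncated [H N] satisfies the full
   recursion. *)
have E : iota 1 (2 * N) = iota 1 n ++ iota (1 + n) (2 * N - n).
  by rewrite -iotaD subnKC //; lia.
rewrite [in LHS](perm_big (iota 1 n ++ iota (1 + n) (2 * N - n))) /=; last by rewrite E.
rewrite big_cat /= [X in _ + X]big_seq [X in _ + X]big1 ?Rplus_0_r; last first.
  by move=> i; rewrite mem_iota => /andP[ni _]; rewrite shift_out ?Rmult_0_r // -add1n.
rewrite (_ : iota 1 n = index_iota 1 n.+1); last by rewrite /index_iota subn1.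
rewrite big_add1 big_mkord; apply: eq_bigr => i _.
by rewrite /shift ltn_ord.
Qed.

End RatioLimit.

(** * The hypotheses *)

Lemma sum_n_iota (a : nat -> R) K : a 0%N = 0 ->
  sum_n a K = \big[Rplus/0]_(j <- iota 1 K) a j.
Proof.
move=> a0; elim: K => [|K IH]; first by rewrite sum_O big_nil.
by rewrite sum_Sn IH -[in iota 1 K.+1](addn1 K) iotaD big_cat /= big_seq1 add1n.
Qed.

Lemma partial_sum_le (c : nat -> R) r l K : (forall j, 0 <= c j) -> c 0%N = 0 -> 0 <= r ->
  is_lim_seq (sum_n (fun n => c n * r ^ n)) (Rbar.Finite l) ->
  \big[Rplus/0]_(j <- iota 1 K) (c j * r ^ j) <= l.
Proof.
move=> c0 c00 r0 L; rewrite -(@sum_n_iota (fun n => c n * r ^ n)) ?c00 ?Rmult_0_l //.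
apply: (is_lim_seq_incr_compare _ _ L) => n; rewrite sum_Sn /plus /=.
have : 0 <= c n.+1 * r ^ n.+1 by apply: Rmult_le_pos => //; exact: pow_le.
by rewrite /=; lra.
Qed.

Lemma gcoef_ge0 (c : nat -> R) : (forall j, 0 <= c j) -> forall j, 0 <= gcoef c j.
Proof. by move=> c0 [|j] /=; [lra|exact: (weight_div_ge0 c0 j.+1)]. Qed.

Lemma sum_gcoef (c : nat -> R) r K :
  \big[Rplus/0]_(j <- iota 1 K) (c j / INR j * r ^ j) =
  \big[Rplus/0]_(j <- iota 1 K) (gcoef c j * r ^ j).
Proof.
rewrite big_seq [RHS]big_seq; apply: eq_bigr => -[|j] //.
by rewrite mem_iota.
Qed.

Lemma sum_bounded_in_radius (c : nat -> R) r : (forall j, 0 <= c j) -> 0 < r ->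
  Rbar_lt r (radius c) ->
  exists B, forall K, \big[Rplus/0]_(j <- iota 1 K) (c j / INR j * r ^ j) <= B.
Proof.
move=> c0 r0 rlt; exists (PSeries (gcoef c) r) => K; rewrite sum_gcoef.
apply: partial_sum_le => //; [exact: gcoef_ge0|lra|].
apply/is_pseries_R/PSeries_correct/CV_radius_inside.
by rewrite Rabs_pos_eq //; lra.
Qed.

(** Serves [Hyp_Sup0], which prescribes no radius for g_theta: convergence is read off the real
    parts of the complex series at a real point. *)
Lemma sum_bounded_extends (c : nat -> R) R0 G r : (forall j, 0 <= c j) ->
  0 < r < R0 -> extends_g c R0 G ->
  exists B, forall K, \big[Rplus/0]_(j <- iota 1 K) (c j / INR j * r ^ j) <= B.
Proof.
move=> c0 [r0 rR] /(_ (RtoC r)); rewrite Cmod_R Rabs_pos_eq; last lra.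
move/(_ rR) => S; exists (fst (G (RtoC r))) => K; rewrite sum_gcoef.
apply: partial_sum_le => //; [exact: gcoef_ge0|lra|].
apply: (filterlim_ext (fun n => fst (sum_n (fun k =>
   scal (pow_n (K := C_Ring) (RtoC r) k) (RtoC (gcoef c k))) n))).
  have powE k : pow_n (K := C_Ring) (RtoC r) k = RtoC (r ^ k).
    elim: k => //= k ->; rewrite RtoC_mult; done.
  elim=> [|n IH]; first by rewrite !sum_O powE /scal /= /mult /=; ring.
  rewrite !sum_Sn -IH powE /plus /= /scal /= /mult /=; ring.
apply/filterlim_locally => eps.
have H := proj1 (filterlim_locally _ _) S eps.
by case: H => n0 Hn0; exists n0 => n /Hn0 [].
Qed.

Lemma hypotheses_radius theta kappa : (forall j, 0 <= theta j) ->
  (Hyp_Sub theta kappa \/ Hyp_Sup1 theta kappa \/ Hyp_Sup0 theta kappa \/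
   Hyp_Crit1 theta kappa \/ Hyp_Crit2 theta kappa \/ Hyp_Crit3 theta kappa) ->
  Rbar_lt 0 (radius kappa) /\
  forall r, 0 < r -> Rbar_lt r (radius kappa) ->
    exists B, forall K, \big[Rplus/0]_(j <- iota 1 K) (theta j / INR j * r ^ j) <= B.
Proof.
move=> t0.
have E : radius theta = radius kappa -> forall r, 0 < r -> Rbar_lt r (radius kappa) ->
    exists B, forall K, \big[Rplus/0]_(j <- iota 1 K) (theta j / INR j * r ^ j) <= B.
  by move=> <- r r0; exact: sum_bounded_in_radius.
case=> [[eqr [R0 _]]|[[R0 [e1 [e2 [R1 _]]]]|[|[[eqr [R0 _]]|[|]]]]].
- by split=> //; exact: E.
- by split; [rewrite e2|apply: E; rewrite e1 e2].
- move=> [R0 [e2 [R1 [eta [phi [Gt [Gk [_ [_ [_ [_ [Et _]]]]]]]]]]]].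
  rewrite e2; split=> // r r0 rR; apply: sum_bounded_extends Et => //.
- by split=> //; exact: E.
- move=> [R0 [e1 [e2 [R1 _]]]].
  by split; [rewrite e2|apply: E; rewrite e1 e2].
- move=> [R0 [e1 [e2 [R1 _]]]].
  by split; [rewrite e2|apply: E; rewrite e1 e2].
Qed.

(** * Partial sums of kappa_j r^j at and beyond [rs] *)

Section Rstar.
Variable kappa : nat -> R.
Hypothesis kappa0 : forall j, 0 <= kappa j.

Lemma gdn1_lim r : 0 < r -> Rbar_lt r (radius kappa) ->
  is_lim_seq (fun K => \big[Rplus/0]_(j <- iota 1 K) (kappa j * r ^ j)) (gdn kappa 1 r).
Proof.
move=> r0 rlt; have rabs : Rabs r = r by rewrite Rabs_pos_eq //; lra.
rewrite /gdn /= Rmult_1_r (Derive_PSeries (gcoef kappa)) ?rabs //.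
have : ex_pseries (PS_derive (gcoef kappa)) r.
  by apply: CV_radius_inside; rewrite CV_radius_derive rabs.
move/PSeries_correct/is_pseries_R/(is_series_scal_l r) => S.
have termE k : scal r (PS_derive (gcoef kappa) k * r ^ k) = kappa k.+1 * r ^ k.+1.
  change (r * (INR k.+1 * (kappa k.+1 / INR k.+1) * r ^ k) = kappa k.+1 * (r * r ^ k)).
  by field; exact: not_0_INR.
apply/is_lim_seq_incr_1; apply: filterlim_ext S => n.
elim: n => [|n IH]; first by rewrite sum_O termE big_seq1.
by rewrite sum_Sn IH termE -[in iota 1 n.+2](addn1 n.+1) iotaD big_cat /= big_seq1 add1n.
Qed.

Lemma gdn1_ge_partial r K : 0 < r -> Rbar_lt r (radius kappa) ->
  \big[Rplus/0]_(j <- iota 1 K) (kappa j * r ^ j) <= gdn kappa 1 r.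
Proof.
move=> r0 rlt; apply: (is_lim_seq_incr_compare _ _ (gdn1_lim r0 rlt)) => n.
apply: big_iota_widen => // j.
by apply: Rmult_le_pos => //; apply: pow_le; lra.
Qed.

(** Passing from rs to r multiplies every term with j >= 1 by at least r / rs. *)
Lemma partial_gt1_beyond rs r K : 0 < rs -> rs < r ->
  rs / r < \big[Rplus/0]_(j <- iota 1 K) (kappa j * rs ^ j) ->
  1 < \big[Rplus/0]_(j <- iota 1 K) (kappa j * r ^ j).
Proof.
move=> rs0 rsr lt; have q1 : 1 <= r / rs.
  by apply: (Rmult_le_reg_r rs) => //; rewrite /Rdiv Rmult_assoc Rinv_l; lra.
apply: (Rlt_le_trans _ (r / rs * \big[Rplus/0]_(j <- iota 1 K) (kappa j * rs ^ j))).
  have := Rmult_lt_compat_l (r / rs) _ _ ltac:(lra) lt.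
  by have -> : r / rs * (rs / r) = 1 by field; lra.
rewrite big_distrr /= big_seq [X in _ <= X]big_seq; apply: big_Rplus_le => j.
rewrite mem_iota => /andP[j1 _].
have -> : r = r / rs * rs by field; lra.
rewrite Rpow_mult_distr; have -> : r / rs * rs / rs = r / rs by field; lra.
have -> : kappa j * ((r / rs) ^ j * rs ^ j) = (r / rs) ^ j * (kappa j * rs ^ j) by ring.
apply: Rmult_le_compat_r; first by apply: Rmult_le_pos => //; apply: pow_le; lra.
case: j j1 => // j _; rewrite -{1}(Rmult_1_r (r / rs)) /=.
by apply: Rmult_le_compat_l; [lra|exact: pow_R1_Rle].
Qed.

(** Otherwise every term kappa_n r^n / n would be at most 1, which forces r to be at most the
    radius. *)
Lemma partial_gt1_outside r : 0 < r -> Rbar_lt (radius kappa) r ->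
  exists K, 1 < \big[Rplus/0]_(j <- iota 1 K) (kappa j * r ^ j).
Proof.
move=> r0 rgt; apply: Classical_Prop.NNPP => nK.
have [ub _] := CV_radius_bounded (gcoef kappa).
suff /ub : exists M, forall n, Rabs (gcoef kappa n * r ^ n) <= M.
  by move=> le; apply: (Rbar_lt_not_le _ _ rgt).
exists 1 => -[|n]; first by rewrite /= Rmult_0_l Rabs_R0; lra.
have rn0 : 0 <= r ^ n.+1 by apply: pow_le; lra.
rewrite Rabs_pos_eq; last by apply: Rmult_le_pos => //; exact: (gcoef_ge0 kappa0).
apply: (Rle_trans _ (kappa n.+1 * r ^ n.+1)).
  apply: Rmult_le_compat_r => //; rewrite /gcoef -{2}(Rdiv_1_r (kappa n.+1)).
  apply: Rmult_le_compat_l => //; apply: Rinv_le_contravar; first lra.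
  by rewrite -[1]/(INR 1); apply: le_INR; lia.
apply: Rnot_lt_le => lt; apply: nK; exists n.+1; apply: Rlt_le_trans lt _.
apply: (@big_Rplus_ge_term _ _ (fun j => kappa j * r ^ j)) => [k _|].
  by apply: Rmult_le_pos => //; apply: pow_le; lra.
by rewrite mem_iota; lia.
Qed.

(** A partial sum is a polynomial, hence continuous at [rs], and to the left of [rs] it is bounded
    by g_kappa^{1}, whose limit is at most 1. *)
Lemma mean_le1_boundary rs l : 0 < rs -> Rbar.Finite rs = radius kappa ->
  gdnR kappa 1 l -> Rbar_le l 1 ->
  forall K, \big[Rplus/0]_(j <- iota 1 K) (kappa j * rs ^ j) <= 1.
Proof.
move=> rs0 rsE; rewrite /gdnR -rsE /toR => lim l1 K.
set S := fun r : R => \big[Rplus/0]_(j <- iota 1 K) (kappa j * r ^ j).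
apply: Rnot_lt_le => gt1; set m := (S rs + 1) / 2.
have mS : m < S rs by rewrite /m /S; lra.
have m1 : 1 < m by rewrite /m /S; lra.
have Scont : continuous S rs.
  rewrite /S; elim: (iota 1 K) => [|j J IH].
    apply: (continuous_ext (fun=> 0)) => [x|]; first by rewrite big_nil.
    exact: continuous_const.
  apply: (continuous_ext (fun x => plus (kappa j * x ^ j) (\big[Rplus/0]_(j <- J) (kappa j * x ^ j)))) => [x|].
    by rewrite big_cons.
  apply: continuous_plus => //; apply: continuous_mult; first exact: continuous_const.
  apply: ex_derive_continuous; apply: ex_derive_pow; exact: ex_derive_id.
have E1 : at_left rs (fun r => m < S r).
  apply: filter_le_within; apply: Scont (fun y => m < y) _.
  exact: open_gt.
have E2 : at_left rs (fun r => gdn kappa 1 r < m).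
  apply: (lim (fun y => y < m)); case: l l1 {lim} => [l|//|_] /=.
    by move=> l1; apply: (open_lt m); lra.
  by exists m.
have E3 : at_left rs (fun r => 0 < r).
  by apply: filter_le_within; apply: (open_gt 0).
have E4 : at_left rs (fun r => r < rs) by exists (mkposreal 1 Rlt_0_1).
have [r [r1 [r2 [r3 r4]]]] := filter_ex _ (filter_and _ _ E1 (filter_and _ _ E2 (filter_and _ _ E3 E4))).
have := @gdn1_ge_partial r K r3; rewrite -rsE => /(_ r4); rewrite -/(S r); lra.
Qed.

(** Inside the disc, the partial sums at [rs] tend to 1 and so exceed rs / r for some K, as
    [partial_gt1_beyond] requires. Both cases on the boundary follow from [mean_le1_boundary] and
    [partial_gt1_outside]. *)
Lemma rstar_spec rs : Rbar_lt 0 (radius kappa) -> is_rstar kappa rs ->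
  [/\ 0 < rs, Rbar_le rs (radius kappa),
     forall K, \big[Rplus/0]_(j <- iota 1 K) (kappa j * rs ^ j) <= 1
   & forall r, rs < r -> exists K, 1 < \big[Rplus/0]_(j <- iota 1 K) (kappa j * r ^ j)].
Proof.
move=> rad0.
have boundary : Rbar.Finite rs = radius kappa -> forall l, gdnR kappa 1 l -> Rbar_le l 1 ->
    [/\ 0 < rs, Rbar_le rs (radius kappa),
     forall K, \big[Rplus/0]_(j <- iota 1 K) (kappa j * rs ^ j) <= 1
   & forall r, rs < r -> exists K, 1 < \big[Rplus/0]_(j <- iota 1 K) (kappa j * r ^ j)].
  move=> rsE l gl l1; have rs0 : 0 < rs by rewrite -rsE in rad0.
  split=> //; first by rewrite -rsE; exact: Rbar_le_refl.
    exact: mean_le1_boundary gl l1.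
  by move=> r rsr; apply: partial_gt1_outside; [lra|rewrite -rsE].
case=> [[l [gl [l1 [rs0 [[rslt g1]|[rsE g1]]]]]]|[l [gl [l1 rsE]]]].
- split=> //; first exact: Rbar_lt_le.
    by move=> K; rewrite -g1; exact: gdn1_ge_partial.
  move=> r rsr; have := gdn1_lim rs0 rslt; rewrite g1 => lim.
  have q0 : 0 < 1 - rs / r.
    apply: Rlt_Rminus; apply: (Rmult_lt_reg_r r); first lra.
    by rewrite /Rdiv Rmult_assoc Rinv_l; lra.
  have [K HK] := proj2 (is_lim_seq_spec _ _) lim (mkposreal _ q0).
  exists K; apply: (partial_gt1_beyond rs0 rsr).
  by have /Rabs_def2 /= := HK K (PeanoNat.Nat.le_refl _); lra.
- by apply: (boundary rsE _ g1); exact: Rbar_le_refl.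
- by apply: (boundary rsE _ gl); exact: Rbar_lt_le.
Qed.

End Rstar.

Unset Implicit Arguments.

Theorem theorem4p6 (theta kappa : nat -> R) :
  standing theta kappa ->
  (Hyp_Sub theta kappa \/ Hyp_Sup1 theta kappa \/ Hyp_Sup0 theta kappa \/
   Hyp_Crit1 theta kappa \/ Hyp_Crit2 theta kappa \/ Hyp_Crit3 theta kappa) ->
  forall rs : R, is_rstar kappa rs ->
  forall (m : nat) (l : nat -> nat),
    (forall i : nat, (1 <= i <= m)%N -> (1 <= l i)%N) ->
    is_lim_seq
      (fun N : nat => @PNev theta kappa N
         (fun s : {perm 'I_N} => all (fun i => lexL s i == l i) (iota 1 m)))
      (Rbar.Finite (prodR (map (fun i => kappa (l i) * rs ^ (l i)) (iota 1 m)))).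
Proof.
move=> [theta0 [kappa0 [aper [j [j2 kj]]]]] hyps rs Hrs m l lpos.
have [rad0 theta_bd] := hypotheses_radius theta0 hyps.
have [rs0 rsle mean_le mean_gt] := rstar_spec kappa0 rad0 Hrs.
rewrite prodR_big; apply: PNev_limit => //.
- move=> r [r0 rrs]; apply: theta_bd => //.
  exact: Rbar_lt_le_trans rsle.
- by exists j; split=> //; exact: ltnW.
Qed.
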